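(* Let $\mathbb{H}$ be a separable real Hilbert space, $X$ a random element of $\mathbb{H}$ that is regularly varying with some index $\alpha>0$ and limit angular measure $P_{\Theta,\infty}$, and let $X_1,X_2,\dots$ be independent copies of $X$. For $1\le k\le n$ let $\widehat C_k=\frac1k\sum_{i=1}^k\Theta_{(i)}\otimes\Theta_{(i)}$, where $\Theta_{(i)}=X_{(i)}/\|X_{(i)}\|$ and $X_{(1)},\dots,X_{(n)}$ is the permutation of $X_1,\dots,X_n$ with $\|X_{(1)}\|\ge\dots\ge\|X_{(n)}\|$, and let $C_\infty=\mathbb{E}[\Theta_\infty\otimes\Theta_\infty]$ with $\Theta_\infty\sim P_{\Theta,\infty}$. Then the empirical covariance of extreme angles $\widehat C_k$ is consistent, i.e. as $n,k\to\infty$ with $k/n\to0$, $$\|\widehat C_k-C_\infty\|_{HS(\mathbb{H})}\to0\quad\text{in probability}.$$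
   Context: For $f,g\in\mathbb{H}$, $f\otimes g$ is the operator $h\mapsto\langle f,h\rangle g$. $HS(\mathbb{H})$ is the Hilbert space of Hilbert–Schmidt operators on $\mathbb{H}$ with norm $\|T\|_{HS(\mathbb{H})}=(\sum_i\|Te_i\|^2)^{1/2}$ for any orthonormal basis $(e_i)$; expectations of operators are Bochner integrals in $HS(\mathbb{H})$. Regular variation. Let $\mathbb{H}_0=\mathbb{H}\setminus\{0\}$. Let $\mathcal{C}_0$ be the set of bounded continuous functions $f:\mathbb{H}_0\to\mathbb{R}$ vanishing in some neighborhood of $0$, and $M_0$ the class of Borel measures on $\mathbb{H}_0$ that are finite on every Borel subset bounded away from $0$. $\mu_n\to\mu$ in $M_0$ if $\int f\,d\mu_n\to\int f\,d\mu$ for all $f\in\mathcal{C}_0$. A measurable function $b$ is regularly varying with index $\rho$ if $b(tx)/b(t)\to x^\rho$ as $t\to\infty$ for every $x>0$. $X$ is regularly varying with index $\alpha>0$ if there exist a nonzero $\mu\in M_0$ and a regularly varying function $b$ such that $b(n)\mathbb{P}(X\in n\,\cdot)\to\mu$ in $M_0$ as $n\to\infty$, where $\mu(tA)=t^{-\alpha}\mu(A)$ for all $t>0$ and Borel $A\subset\mathbb{H}_0$. Known equivalent characterization (polar form): $X$ is regularly varying with index $\alpha$ if and only if $\|X\|$ is regularly varying in $\mathbb{R}$ with index $\alpha$ and there is a probability measure $P_{\Theta,\infty}$ on the unit sphere of $\mathbb{H}$ such that $\mathbb{P}(X/\|X\|\in\cdot\mid\|X\|>t)\to P_{\Theta,\infty}$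 weakly as $t\to\infty$; this $P_{\Theta,\infty}$ is the limit angular measure. *)

(* Defs.v *)
From HB Require Import structures.
From mathcomp Require Import all_boot all_order all_algebra all_fingroup.
From mathcomp Require Import all_classical all_reals all_analysis.

Set Implicit Arguments.
Unset Strict Implicit.
Unset Printing Implicit Defensive.

Import Order.TTheory GRing.Theory Num.Theory.
Import numFieldNormedType.Exports.

Local Open Scope classical_set_scope.
Local Open Scope ring_scope.

HB.mixin Record CompleteNormedModule_isHilbert (R : realType) H
    of CompleteNormedModule R H := {
  hdot : H -> H -> R ;
  hdotC : forall x y, hdot x y = hdot y x ;
  hdotDl : forall x y z, hdot (x + y) z = hdot x z + hdot y z ;
  hdotZl : forall (a : R) x y, hdot (a *: x) y = a * hdot x y ;
  hdotxx : forall x, hdot x x = `|x| ^+ 2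
}.

#[short(type="hilbertType")]
HB.structure Definition Hilbert (R : realType) :=
  {H of CompleteNormedModule_isHilbert R H & CompleteNormedModule R H}.

Definition separable (T : topologicalType) :=
  exists2 D : set T, countable D & dense D.

Notation borel T := (g_sigma_algebraType (@open T)).

Section hilbert_schmidt.
Context {R : realType} {H : hilbertType R}.
Implicit Types (B : set H) (S : H -> H).

Definition tensor (f g : H) : H -> H := fun h => hdot f h *: g.

Definition lin_span B : set H :=
  [set v | exists (s : seq H) (a : H -> R),
     (forall e, e \in s -> B e) /\ v = \sum_(e <- s) a e *: e].

Definition orthonormal_basis B : Prop :=
  [/\ forall e, B e -> hdot e e = 1,
      forall e f, B e -> B f -> e <> f -> hdot e f = 0
    & closure (lin_span B) = setT].

Definition HS_norm B S : \bar R :=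
  sqrte (\esum_(e in B) (`|S e| ^+ 2)%:E).

Definition HS B : set (H -> H) :=
  [set S | [/\ linear S, continuous S & (HS_norm B S < +oo)%E]].

End hilbert_schmidt.

(* Bochner integral, in HS(H), of an operator-valued map against a
   probability. *)
Section bochner.
Context {R : realType} {H : hilbertType R} {d : measure_display}
  {T : measurableType d}.
Variables (B : set H) (P : probability T R).
Implicit Types (F s : T -> H -> H) (C : H -> H).

Definition HS_simple s : Prop :=
  [/\ finite_set (range s),
      forall S, measurable (s @^-1` [set S])
    & forall w, HS B (s w)].

Definition HS_simple_integral s : H -> H :=
  \sum_(S \in range s) fine (P (s @^-1` [set S])) *: S.

Definition is_HS_expectation F C : Prop :=
  HS B C /\ exists s_ : nat -> T -> H -> H,
  [/\ forall n, HS_simple (s_ n),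
      {ae P, forall w, HS_norm B (s_ n w - F w)%R @[n --> \oo] --> 0%E},
      (\int[P]_w HS_norm B (s_ n w - F w)%R)%E @[n --> \oo] --> 0%E
    & HS_norm B (HS_simple_integral (s_ n) - C)%R @[n --> \oo] --> 0%E].

(* [get] returns a default operator when F is not Bochner integrable. *)
Definition HS_expectation F : H -> H := get (is_HS_expectation F).

End bochner.

(* Measures on H \ {0} and on the unit sphere are represented by measures on
   the Borel sets of H that are only evaluated, and only integrate functions,
   on these subsets. *)
Section regular_variation.
Context {R : realType} {H : hilbertType R}.

Definition punctured : set H := ~` [set 0].

Definition unit_sphere : set H := [set x | `|x| = 1].

(* For x = 0 this is 0. *)
Definition angle (x : H) : H := `|x|^-1 *: x.

Definition C0 (f : H -> R) : Prop :=
  [/\ {within punctured, continuous f},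
      exists M : R, forall x, punctured x -> `|f x| <= M
    & exists2 r : R, 0 < r & forall x, punctured x -> `|x| < r -> f x = 0].

Definition M0 (mu : {measure set (borel H) -> \bar R}) : Prop :=
  forall A : set (borel H), measurable A -> A `<=` punctured ->
    (exists2 r : R, 0 < r & forall x : H, A x -> r <= `|x|) ->
    (mu A < +oo)%E.

Definition M0_cvg (mu_ : nat -> set (borel H) -> \bar R)
    (mu : set (borel H) -> \bar R) : Prop :=
  forall f : H -> R, C0 f ->
    (\int[mu_ n]_(x in punctured) (f x)%:E)%E @[n --> \oo] -->
    (\int[mu]_(x in punctured) (f x)%:E)%E.

Definition regularly_varying_fun (b : R -> R) (rho : R) : Prop :=
  measurable_fun (`]0%R, +oo[ : set R) b /\
  forall x : R, 0 < x -> b (t * x) / b t @[t --> +oo] --> x `^ rho.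

Definition dilate (t : R) (A : set H) : set H := [set t *: x | x in A].

Definition regularly_varying {d : measure_display} {T : measurableType d}
    (P : probability T R) (X : T -> H) (alpha : R) : Prop :=
  0 < alpha /\
  exists (mu : {measure set (borel H) -> \bar R}) (b : R -> R),
  [/\ M0 mu /\ mu punctured <> 0%E,
      exists rho, regularly_varying_fun b rho,
      M0_cvg (fun n A => (b n%:R)%:E * P (X @^-1` dilate n%:R A))%E mu
    & forall (t : R) (A : set (borel H)), 0 < t -> measurable A ->
        A `<=` punctured ->
        mu (dilate t A) = ((t `^ (- alpha))%:E * mu A)%E].

(* P(X / |X| \in A | |X| > t) *)
Definition angle_law_above {d : measure_display} {T : measurableType d}
    (P : probability T R) (X : T -> H) (t : R) (A : set (borel H)) : \bar R :=
  (P [set w | A (angle (X w)) /\ (t < `|X w|)%R]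
   * ((fine (P [set w | (t < `|X w|)%R]))^-1)%:E)%E.

Definition limit_angular_measure {d : measure_display} {T : measurableType d}
    (P : probability T R) (X : T -> H) (Q : probability (borel H) R) : Prop :=
  Q unit_sphere = 1%E /\
  forall f : H -> R, {within unit_sphere, continuous f} ->
    (exists M : R, forall x, unit_sphere x -> `|f x| <= M) ->
    (\int[angle_law_above P X t]_(x in unit_sphere) (f x)%:E)%E @[t --> +oo]
      --> (\int[Q]_(x in unit_sphere) (f x)%:E)%E.

End regular_variation.

Section sampling.
Context {R : realType} {H : hilbertType R} {d : measure_display}
  {T : measurableType d}.
Implicit Types (P : probability T R) (X : nat -> T -> H).

Definition mutually_independent P X : Prop :=
  forall (J : seq nat) (A : nat -> set (borel H)), uniq J ->
    (forall i, measurable (A i)) ->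
    P (\bigcap_(i in [set` J]) (X i @^-1` A i)) =
    (\prod_(i <- J) P (X i @^-1` A i))%E.

(* A sample of size n consists of X 0, ..., X (n - 1), and X (sigma n w i) w is
   the (i + 1)-th order statistic. Ties in norm may be broken in any
   measurable way. *)
Definition norm_ordering X (sigma : forall n, T -> 'S_n) : Prop :=
  (forall n (s : 'S_n), measurable (sigma n @^-1` [set s])) /\
  (forall n w (i j : 'I_n), (i <= j)%N ->
     `|X (sigma n w j) w| <= `|X (sigma n w i) w|).

Definition emp_cov X (sigma : forall n, T -> 'S_n) (n k : nat) (w : T) :
    H -> H :=
  let Theta i := angle (X (sigma n w i) w) in
  k%:R^-1 *: \sum_(i < n | (i < k)%N) tensor (Theta i) (Theta i).

End sampling.

(* Main.v *)
Require Import Defs.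
From mathcomp Require Import all_boot all_order all_algebra all_fingroup.
From mathcomp Require Import all_classical all_reals all_analysis.
From mathcomp Require Import measurable_realfun.
From mathcomp Require Import ring lra.

(* Three ideas carry the proof.

   Let V(t) = P(|X| > t).  For any deterministic level t, the set of the k
   largest observations and the set of the observations of norm > t are nested,
   whatever the tie-breaking, so the average of psi over the k extreme angles
   differs from 1/k * sum_i psi(angle X_i) 1(|X_i| > t) by at most
   sup |psi| * |N(t)/k - 1|, where N(t) counts the exceedances of t.  Both sums
   are sums of i.i.d. terms, so Chebyshev's inequality gives a law of large
   numbers for psi once levels t_n -> oo with n V(t_n) / k_n -> 1 are available.

   Such levels exist as soon as V(m) / V(m + 1) -> 1 along the integers.  This
   is where regular variation enters (it excludes atoms of |X| comparable to the
   tail, for which ties could be broken adversarially); it follows from the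
       convergence in M_0 tested on radial ramp
   functions together with the homogeneity of mu, without Karamata theory.

   For an orthonormal basis, the squared Hilbert-Schmidt distance is the sum of
   the squared differences of the coordinates <e, theta><f, theta>, averaged
   over the sample or over Q.  By Jensen, the coordinates outside a finite block
   F x F contribute at most twice the sum of the two averages of
   1 - |pi_F theta|^4, where pi_F is the orthogonal projection onto the span of
   F; so the law of large numbers is only needed for finitely many functions. *)

Set Implicit Arguments.
Unset Strict Implicit.
Unset Printing Implicit Defensive.

Import Order.TTheory GRing.Theory Num.Theory.
Import numFieldNormedType.Exports.

Local Open Scope classical_set_scope.
Local Open Scope ring_scope.

(** * Hilbert space geometry *)

(** Statements on operators are reduced to real coordinates. For [eps >= 0] a Hilbert-Schmidt norm
    exceeds [eps] exactly when some finite block of squared coordinates exceeds [eps ^+ 2], so the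
    event of the theorem is a countable union of events in bounded real variables.

    [HS_expectation] is a [get]: the limit operator carries information only once a Bochner
    expectation is exhibited. It is obtained from the tensor squares of a discretized angle, and
    every operator satisfying the definition has the expected coordinates.

    Convergence in M_0 is available only along the integers, for continuous tests, and with a factor
    b(n) of unknown sign. Hence the levels are integers, tails are squeezed between ramps, and the
    positivity of b(n) is extracted from a positive limit.

    The average over the extremes and the integral against Q are both positive normalized linear
    functionals, and the estimate outside a block is proved once for all of these. *)

Lemma ler_sum_subset_uniq {R : realType} {T : eqType} (F : T -> R)
    (s t : seq T) :
  uniq s -> uniq t -> {subset s <= t} -> (forall x, 0 <= F x) ->
  \sum_(x <- s) F x <= \sum_(x <- t) F x.
Proof.
move=> us ut st F0; rewrite [leRHS](bigID (mem s))/=.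
rewrite -[X in X + _]big_filter; suff /(perm_big _) -> :
  perm_eq [seq x <- t | x \in s] s by rewrite lerDl sumr_ge0.
apply: uniq_perm => //; first exact: filter_uniq.
by move=> x; rewrite mem_filter /=; case: (boolP (x \in s)) => // /st ->.
Qed.

Section inner_product.
Context {R : realType} {H : hilbertType R}.
Implicit Types (x y z e : H) (s : seq H) (B : set H).

Lemma hdotDr x y z : hdot x (y + z) = hdot x y + hdot x z.
Proof. by rewrite hdotC hdotDl !(hdotC x). Qed.

Lemma hdotZr (a : R) x y : hdot x (a *: y) = a * hdot x y.
Proof. by rewrite hdotC hdotZl hdotC. Qed.

Lemma hdot0l x : hdot 0 x = 0.
Proof. by rewrite -(scale0r x) hdotZl mul0r. Qed.

Lemma hdotNl x y : hdot (- x) y = - hdot x y.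
Proof. by rewrite -scaleN1r hdotZl mulN1r. Qed.

Lemma hdotNr x y : hdot x (- y) = - hdot x y.
Proof. by rewrite hdotC hdotNl hdotC. Qed.

Lemma hdotBl x y z : hdot (x - y) z = hdot x z - hdot y z.
Proof. by rewrite hdotDl hdotNl. Qed.

Lemma hdotBr x y z : hdot x (y - z) = hdot x y - hdot x z.
Proof. by rewrite hdotDr hdotNr. Qed.

Lemma hdot_suml I (r : seq I) (p : pred I) (F : I -> H) y :
  hdot (\sum_(i <- r | p i) F i) y = \sum_(i <- r | p i) hdot (F i) y.
Proof.
by apply: (big_morph (hdot^~ y)) => [u v|]; [exact: hdotDl|exact: hdot0l].
Qed.

Lemma hdot_sumr I (r : seq I) (p : pred I) (F : I -> H) y :
  hdot y (\sum_(i <- r | p i) F i) = \sum_(i <- r | p i) hdot y (F i).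
Proof. by rewrite hdotC hdot_suml; apply: eq_bigr => i _; rewrite hdotC. Qed.

Lemma hdot_CauchySchwarz x y : `|hdot x y| <= `|x| * `|y|.
Proof.
have [->|x0] := eqVneq x 0; first by rewrite hdot0l !normr0 mul0r.
have nx : 0 < `|x| by rewrite normr_gt0.
rewrite -(@ler_pXn2r _ 2) ?nnegrE ?mulr_ge0// real_normK ?num_real// exprMn.
have := sqr_ge0 `|(`|x| ^+ 2) *: y - hdot x y *: x|.
rewrite -hdotxx !(hdotBl,hdotBr,hdotZl,hdotZr) !hdotxx (hdotC y x) => h.
have {}h : 0 <= `|x| ^+ 2 * (`|x| ^+ 2 * `|y| ^+ 2 - hdot x y ^+ 2) by lra.
by move: h; rewrite pmulr_rge0 ?exprn_gt0// subr_ge0.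
Qed.

Lemma eq_hdot x y : (forall z, hdot x z = hdot y z) -> x = y.
Proof.
move=> xy; apply/eqP; rewrite -subr_eq0 -normr_eq0 -sqrf_eq0 -hdotxx hdotBl.
by rewrite xy subrr.
Qed.

Lemma norm_le_hdot x (M : R) : 0 <= M ->
  (forall z, hdot x z <= M * `|z|) -> `|x| <= M.
Proof.
move=> M0 xM; have [->|x0] := eqVneq x 0; first by rewrite normr0.
have nx : 0 < `|x| by rewrite normr_gt0.
by have := xM x; rewrite hdotxx expr2 ler_pM2r.
Qed.

Lemma sqr_normB x y : `|x - y| ^+ 2 = `|x| ^+ 2 - 2 * hdot x y + `|y| ^+ 2.
Proof. by rewrite -hdotxx hdotBl !hdotBr !hdotxx (hdotC y x); ring. Qed.

Lemma continuous_hdotr y : continuous (hdot y).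
Proof.
move=> x; apply/cvgrPdist_lt => e e0.
near=> z; rewrite -hdotBr (le_lt_trans (hdot_CauchySchwarz _ _))//.
have y1 : 0 < `|y| + 1 by rewrite ltr_wpDl.
apply: (@le_lt_trans _ _ ((`|y| + 1) * `|x - z|)).
  by rewrite ler_wpM2r// lerDl.
rewrite mulrC -ltr_pdivlMr//.
near: z; apply: (@cvgr_dist_lt _ _ _ (nbhs x) _ id); first exact: cvg_id.
by rewrite divr_gt0.
Unshelve. all: by end_near. Qed.

End inner_product.

(** * Finite orthogonal projections, Bessel and Parseval *)

Section orthonormal.
Context {R : realType} {H : hilbertType R}.
Implicit Types (x y z e : H) (s : seq H).
Variable B : set H.
Hypothesis oB : orthonormal_basis B.

Definition hproj s x : H := \sum_(e <- s) hdot e x *: e.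

Let dotB e f : B e -> B f -> hdot e f = (e == f)%:R.
Proof.
case: oB => o1 o2 _ Be Bf; case: eqVneq => [<-|/eqP ef] /=; first exact: o1.
exact: o2.
Qed.

Lemma hdot_hproj s x e : uniq s -> (forall f, f \in s -> B f) -> e \in s ->
  hdot e (hproj s x) = hdot e x.
Proof.
move=> us sB es; rewrite hdot_sumr (bigD1_seq e)//= hdotZr (dotB (sB _ es) (sB
    _ es)) eqxx.
rewrite mulr1 big1_seq ?addr0// => f /andP[fe fs].
by rewrite hdotZr (dotB (sB _ es) (sB _ fs)) eq_sym (negbTE fe) mulr0.
Qed.

Lemma hdot_hprojr s x : uniq s -> (forall f, f \in s -> B f) ->
  hdot (hproj s x) x = \sum_(e <- s) hdot e x ^+ 2.
Proof.
by move=> us sB; rewrite hdot_suml; apply: eq_bigr => e _; rewrite hdotZl expr2.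
Qed.

Lemma sqr_norm_hproj s x : uniq s -> (forall f, f \in s -> B f) ->
  `|hproj s x| ^+ 2 = \sum_(e <- s) hdot e x ^+ 2.
Proof.
move=> us sB; rewrite -hdotxx {1}/hproj hdot_suml; apply: eq_big_seq => e es.
by rewrite hdotZl hdot_hproj// expr2.
Qed.

Lemma sqr_norm_sub_hproj s x : uniq s -> (forall f, f \in s -> B f) ->
  `|x - hproj s x| ^+ 2 = `|x| ^+ 2 - \sum_(e <- s) hdot e x ^+ 2.
Proof.
move=> us sB; rewrite sqr_normB (hdotC x) hdot_hprojr// sqr_norm_hproj//; lra.
Qed.

Lemma bessel s x : uniq s -> (forall f, f \in s -> B f) ->
  \sum_(e <- s) hdot e x ^+ 2 <= `|x| ^+ 2.
Proof. by move=> us sB; rewrite -subr_ge0 -sqr_norm_sub_hproj ?sqr_ge0. Qed.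

(** The residual is orthogonal to the span, so its square is its inner product with [x - v], and
    Cauchy-Schwarz concludes. Repetitions are allowed in [t], as they are in [lin_span]. *)
Lemma hproj_best s x (a : H -> R) : uniq s -> (forall f, f \in s -> B f) ->
  forall t, {subset t <= s} ->
  `|x - hproj s x| <= `|x - \sum_(e <- t) a e *: e|.
Proof.
move=> us sB t ts; set p := hproj s x; set v := \sum_(_ <- t) _.
have ort e : e \in s -> hdot e (x - p) = 0.
  by move=> es; rewrite hdotBr hdot_hproj// subrr.
have [->|n0] := eqVneq (x - p) 0; first by rewrite normr0.
have nx : 0 < `|x - p| by rewrite normr_gt0.
rewrite -(ler_pM2l nx) -expr2.
suff -> : `|x - p| ^+ 2 = hdot (x - p) (x - v).
  exact: le_trans (ler_norm _) (hdot_CauchySchwarz _ _).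
rewrite -hdotxx !(hdotBr (x - p)); congr (_ - _).
have z w (c : H -> R) : {subset w <= s} ->
    hdot (x - p) (\sum_(e <- w) c e *: e) = 0.
  move=> ws; rewrite hdot_sumr big1_seq// => e /andP[_ /ws es].
  by rewrite hdotZr hdotC ort// mulr0.
by rewrite z// /p /hproj z.
Qed.

Lemma parseval_approx x (eps : R) : 0 < eps -> exists s,
  [/\ uniq s, forall e, e \in s -> B e & `|x| ^+ 2 - \sum_(e <- s) hdot e x ^+
      2 < eps].
Proof.
move=> eps0; case: oB => _ _ cB.
have : closure (lin_span B) x by rewrite cB.
(* A residual below both 1 and [eps] has its square below [eps]. *)
pose d := Num.min 1 eps.
have d0 : 0 < d by rewrite lt_min ltr01.
move=> /(_ _ (nbhsx_ballx x d d0))[v [[s [a [sB ->]]]]].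
rewrite -ball_normE /= => xv.
have usB e : e \in undup s -> B e by rewrite mem_undup => /sB.
exists (undup s); split => //; first exact: undup_uniq.
rewrite -sqr_norm_sub_hproj ?undup_uniq//.
have xd : `|x - hproj (undup s) x| < d.
  apply: le_lt_trans xv; apply: hproj_best => //; first exact: undup_uniq.
  by move=> e; rewrite mem_undup.
have := normr_ge0 (x - hproj (undup s) x).
move: xd; rewrite /d lt_min => /andP[]; set u := `|_|; nra.
Qed.

End orthonormal.

(** * Exhaustion of a basis by finite blocks *)

Section basis_exhaustion.
Context {R : realType} {H : hilbertType R}.
Variable B : set H.
Hypotheses (sH : separable H) (oB : orthonormal_basis B).

(** Distinct elements of [B] are at distance sqrt 2, so at most one of them lies within 1/2 of a
    given point of the dense set. *)
Lemma countable_orthonormal_basis : countable B.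
Proof.
case: sH => D cD dD.
have near e : exists d : H, D d /\ `|e - d| < 2^-1.
  have [d [ed Dd]] : (ball e (2^-1 : R) `&` D) !=set0.
    apply: dD; first by exists e; apply: ballxx; rewrite invr_gt0.
    exact: ball_open.
  by exists d; split=> //; rewrite -ball_normE in ed.
have [g gP] := choice near.
have /countable_injP[i iinj] := cD.
apply/countable_injP; exists (i \o g) => e f /set_mem Be /set_mem Bf /= egf.
have {}egf : g e = g f by apply: iinj => //; apply/mem_set; [case: (gP e)|case:
    (gP f)].
case: oB => o1 o2 _; apply/eqP/negPn/negP => /eqP nef.
have [_ h1] := gP e; have [_ h2] := gP f.
have h3 : `|e - f| < 1.
  have -> : e - f = (e - g e) - (f - g f) by rewrite egf opprB addrA subrK.
  by rewrite (le_lt_trans (ler_normB _ _))//; lra.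
have := sqr_normB e f; rewrite o2// -(hdotxx e) -(hdotxx f) !o1// mulr0 subr0.
have := normr_ge0 (e - f); nra.
Qed.

(** [F n] collects the basis elements whose index under an injection into the naturals is less than
    [n]; finite and infinite bases are treated alike. *)
Lemma exists_basis_exhaustion : exists F : nat -> seq H,
  [/\ forall n, uniq (F n), forall n e, e \in F n -> B e,
      forall m n, (m <= n)%N -> {subset F m <= F n}
    & forall e, B e -> exists n, e \in F n].
Proof.
have /countable_injP[i iinj] := countable_orthonormal_basis.
have fin n : exists s : seq H, uniq s /\ forall e, (e \in s) <-> (B e /\ (i e <
    n)%N).
  have : finite_set [set e | B e /\ (i e < n)%N].
    set A := [set e | _].
    have : (i @` A #= A)%card.
      apply: inj_card_eq => e f /set_mem[Be _] /set_mem[Bf _].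
      by apply: iinj; exact/mem_set.
    move=> /eq_finite_set <-.
    by apply: sub_finite_set (finite_II n) => _ [e [_ ien] <-].
  move=> /finite_seqP[s sE]; exists (undup s); split; first exact: undup_uniq.
  move=> e; rewrite mem_undup.
  by move/seteqP: sE => [h1 h2]; split => [/h2|/h1].
have [F FP] := choice fin; exists F; split.
- by move=> n; case: (FP n).
- by move=> n e /(FP n).2[].
- move=> m n mn e /(FP m).2[Be iem]; apply/(FP n).2; split=> //.
  exact: leq_trans iem mn.
- by move=> e Be; exists (i e).+1; apply/(FP _).2.
Qed.

End basis_exhaustion.

(** * Hilbert-Schmidt norm in coordinates *)

Section hs_coordinates.
Context {R : realType} {H : hilbertType R}.
Implicit Types (x : H) (S : H -> H).
Variables (B : set H) (F : nat -> seq H).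
Hypothesis oB : orthonormal_basis B.
Hypothesis uF : forall n, uniq (F n).
Hypothesis FB : forall n e, e \in F n -> B e.
Hypothesis F_homo : forall m n, (m <= n)%N -> {subset F m <= F n}.
Hypothesis F_exhausts : forall e, B e -> exists n, e \in F n.

(** The squared Hilbert-Schmidt norm of a finite block of the matrix of [S]. *)
Definition hs_trunc S n : R :=
  \sum_(e <- F n) \sum_(f <- F n) hdot f (S e) ^+ 2.

Lemma sub_basis_exhaustion (s : seq H) : (forall e, e \in s -> B e) ->
  exists n, {subset s <= F n}.
Proof.
elim: s => [|e s IH] sB; first by exists 0%N.
have [m sm] := IH (fun f fs => sB f (mem_behead (s := e :: s) fs)).
have [n en] := F_exhausts (sB e (mem_head _ _)).
exists (maxn m n) => f; rewrite inE => /predU1P[->|/sm fm].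
  exact: F_homo (leq_maxr m n) _ en.
exact: F_homo (leq_maxl m n) _ fm.
Qed.

Lemma parseval x : \sum_(e <- F n) hdot e x ^+ 2 @[n --> \oo] --> `|x| ^+ 2.
Proof.
apply/cvgrPdist_lt => eps eps0.
have [s [us sB sx]] := parseval_approx oB x eps0.
have [m sm] := sub_basis_exhaustion sB.
near=> n; have mn : (m <= n)%N by near: n; exists m.
rewrite ger0_norm; last by rewrite subr_ge0 (bessel oB)// => f; exact: FB.
apply: le_lt_trans sx; rewrite lerD2l lerN2 ler_sum_subset_uniq//.
  by move=> e /sm; exact: F_homo.
by move=> e; rewrite sqr_ge0.
Unshelve. all: by end_near. Qed.

Lemma hs_trunc_ge0 S n : 0 <= hs_trunc S n.
Proof. by do 2!apply: sumr_ge0 => ? _; rewrite sqr_ge0. Qed.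

(** A finite subfamily of [B] lies in some [F m]. For [n >= m] the sum over it, each squared norm
    being truncated to [F n], is part of [hs_trunc S n]; Parseval then removes the truncation. *)
Lemma esum_sqr_norm_le S (M : R) : (forall n, hs_trunc S n <= M) ->
  (\esum_(e in B) (`|S e| ^+ 2)%:E <= M%:E)%E.
Proof.
move=> SM; apply: ge_ereal_sup => _ [A [finA AB] <-].
move: finA AB => /finite_seqP[s0 ->] AB.
have sB e : e \in undup s0 -> B e by rewrite mem_undup => /AB.
have -> : [set` s0] = [set` undup s0].
  by apply/seteqP; split=> e /=; rewrite mem_undup.
rewrite -fsbig_seq ?undup_uniq//= sumEFin lee_fin.
set s := undup s0 in sB *; have [m sm] := sub_basis_exhaustion sB.
have : \sum_(e <- s) \sum_(f <- F n) hdot f (S e) ^+ 2 @[n --> \oo] -->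
    \sum_(e <- s) `|S e| ^+ 2.
  by apply: cvg_big => [|e _]; [exact: add_continuous|exact: parseval].
apply: (@closed_cvg _ _ \oo _ _ (fun y : R => y <= M) (@closed_le _ M)).
near=> n; have mn : (m <= n)%N by near: n; exists m.
apply: le_trans (SM n); apply: ler_sum_subset_uniq; rewrite ?undup_uniq//.
  by move=> e /sm; exact: F_homo.
by move=> e; apply: sumr_ge0 => f _; rewrite sqr_ge0.
Unshelve. all: by end_near. Qed.

Lemma hs_trunc_le_esum S n :
  ((hs_trunc S n)%:E <= \esum_(e in B) (`|S e| ^+ 2)%:E)%E.
Proof.
apply: le_trans (ereal_sup_ubound _); last first.
  exists [set` F n] => //; split; first exact: finite_seq.
  by move=> e; exact: FB.
rewrite -fsbig_seq//= sumEFin lee_fin.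
by apply: ler_sum => e _; apply: (bessel oB) => // f; exact: FB.
Qed.

Lemma HS_norm_ge0 S : (0 <= HS_norm B S)%E.
Proof. exact: sqrte_ge0. Qed.

(** Bounds on an extended-real supremum become bounds on finite real sums; finiteness of the norm is
    a consequence of the right-hand side and not a prerequisite. *)
Lemma HS_norm_leP S (M : R) : 0 <= M ->
  (HS_norm B S <= M%:E)%E <-> (forall n, hs_trunc S n <= M ^+ 2).
Proof.
move=> M0; have -> : M%:E = sqrte (M ^+ 2)%:E.
  by rewrite /= sqrtr_sqr ger0_norm.
rewrite lee_sqrt ?lee_fin ?sqr_ge0//; split; last exact: esum_sqr_norm_le.
by move=> h n; rewrite -lee_fin; apply: le_trans h; exact: hs_trunc_le_esum.
Qed.

Lemma HS_norm_gtP S (M : R) : 0 <= M ->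
  (M%:E < HS_norm B S)%E <-> (exists n, M ^+ 2 < hs_trunc S n).
Proof.
move=> M0; split => [|[n]]; rewrite !ltNge.
  apply: contraNP => /forallNP h; apply/HS_norm_leP => // n.
  by rewrite leNgt; apply/negP/h.
by apply: contra => /(HS_norm_leP _ M0)/(_ n).
Qed.

(** Some block contains both [e] and [f]. Coordinates are thereby continuous for the Hilbert-Schmidt
    norm, which is what determines a Bochner expectation. *)
Lemma coord_le_HS_norm S e f : B e -> B f -> (`|hdot f (S e)|%:E <= HS_norm B
    S)%E.
Proof.
move=> Be Bf; rewrite leNgt; apply/negP => h.
have efB g : g \in [:: e; f] -> B g by rewrite !inE => /orP[] /eqP ->.
have [m em] := sub_basis_exhaustion efB.
have nn := HS_norm_ge0 S.
have fn : HS_norm B S \is a fin_num.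
  by rewrite ge0_fin_numE// (lt_trans h)// ltry.
move: h; rewrite -[X in (X < _)%E]fineK// lte_fin.
apply/negP; rewrite -leNgt -ler_sqr ?nnegrE ?fine_ge0//.
have /HS_norm_leP/(_ m) : (HS_norm B S <= (fine (HS_norm B S))%:E)%E by rewrite
    fineK.
move=> /(_ (fine_ge0 nn)); apply: le_trans; rewrite real_normK ?num_real//.
rewrite /hs_trunc (bigD1_seq e) ?em ?mem_head//= (bigD1_seq f) ?em ?inE ?eqxx
    ?orbT//=.
rewrite -addrA lerDl addr_ge0 ?sumr_ge0// => g _; rewrite ?sqr_ge0//.
by apply: sumr_ge0 => ? _; rewrite sqr_ge0.
Qed.

End hs_coordinates.

(** * Borel measurability *)

Section borel_measurability.
Context {R : realType} {H : hilbertType R}.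

Lemma measurable_open_borel (A : set H) : open A -> measurable (A : set (borel
    H)).
Proof. by move=> oA; exact: sub_sigma_algebra. Qed.

Lemma measurable_closed_borel (A : set H) :
  closed A -> measurable (A : set (borel H)).
Proof.
move=> cA; rewrite -(setCK A); apply: measurableC.
by apply: measurable_open_borel; exact: closed_openC.
Qed.

Lemma continuous_borel_measurable (f : H -> R) : continuous f ->
  measurable_fun [set: borel H] (f : borel H -> R).
Proof.
move=> cf; apply: (measurability _ (RGenOInfty.measurableE R)) => //.
move=> _ [_ [a ->] <-]; rewrite setTI; apply: measurable_open_borel.
by move/continuousP: cf; apply; exact: interval_open.
Qed.

Lemma continuous_borel_borel_measurable (f : H -> H) : continuous f ->
  measurable_fun [set: borel H] (f : borel H -> borel H).
Proof.
move=> cf; apply: (@measurability _ _ (borel H) (borel H) _ _ (@open H)) => //.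
move=> _ [A oA <-]; rewrite setTI; apply: measurable_open_borel.
by move/continuousP: cf; apply.
Qed.

Lemma measurable_set1_borel (v : H) : measurable ([set v] : set (borel H)).
Proof.
have -> : [set v] = (fun x : H => `|x - v|) @^-1` [set 0].
  apply/seteqP; split => x /= => [->|/eqP]; first by rewrite subrr normr0.
  by rewrite normr_eq0 subr_eq0 => /eqP.
apply: measurable_closed_borel; apply: closed_comp; last exact: closed_eq.
by move=> x _; apply: cvg_norm; apply: cvgB; [exact: cvg_id|exact: cvg_cst].
Qed.

Lemma measurable_punctured : measurable (@punctured R H : set (borel H)).
Proof. by apply: measurableC; exact: measurable_set1_borel. Qed.

Lemma measurable_unit_sphere : measurable (@unit_sphere R H : set (borel H)).
Proof.
apply: measurable_closed_borel; apply: (@closed_comp _ _ (fun x : H => `|x|)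
    [set 1]).
  by move=> x _; exact: norm_continuous.
exact: closed_eq.
Qed.

Lemma angle0 : angle (0 : H) = 0.
Proof. by rewrite /angle scaler0. Qed.

Lemma norm_angle (x : H) : x != 0 -> `|angle x| = 1.
Proof.
move=> x0; rewrite normrZ ger0_norm ?invr_ge0// mulVf//.
by rewrite normr_eq0.
Qed.

Lemma norm_angle_le1 (x : H) : `|angle x| <= 1.
Proof. by have [->|/norm_angle->//] := eqVneq x 0; rewrite angle0 normr0. Qed.

Lemma continuous_angle (x : H) : x != 0 -> {for x, continuous (@angle R H)}.
Proof.
move=> x0; apply: cvgZ; last exact: cvg_id.
by apply: cvgV; [rewrite normr_eq0|exact: norm_continuous].
Qed.

(** Normalization is continuous off 0, and the single point 0 is itself measurable. *)
Lemma measurable_angle : measurable_fun [set: borel H] (@angle R H : borel H ->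
    borel H).
Proof.
apply: (@measurability _ _ (borel H) (borel H) _ _ (@open H)) => // _ [A oA
    <-]; rewrite setTI.
have -> : angle @^-1` A = ((angle @^-1` A) `&` punctured) `|`
    ((angle @^-1` A) `&` [set 0]).
  by rewrite -setIUr /punctured setUC setUv setIT.
apply: measurableU; last first.
  have [A0|A0] := pselect (A 0).
    have -> : angle @^-1` A `&` [set 0] = [set 0].
      by apply/seteqP; split=> x [] //= ->; split; rewrite //= angle0.
    exact: measurable_set1_borel.
  have -> : angle @^-1` A `&` [set 0] = set0; last exact: measurable0.
  by apply/seteqP; split=> x // [] /= /[swap] ->; rewrite angle0.
apply: measurable_open_borel; rewrite openE => x [Ax] /= /eqP x0.
apply: filterI.
  by apply: (continuous_angle x0); apply: open_nbhs_nbhs; split.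
have : \forall z \near x, 0 < `|z|.
  by apply: (cvgr_gt `|x|); [exact: norm_continuous|rewrite normr_gt0].
by apply: filterS => z /=; rewrite normr_gt0 => /eqP.
Qed.

End borel_measurability.

(** * Expectation of bounded random variables *)

Section mean.
Context {d : measure_display} {T : measurableType d} {R : realType}.
Variable P : probability T R.
Implicit Types (f g : T -> R) (A : set T).

(** A class closed under sums, products and measurable substitutions, all of whose members are
    integrable for a probability: integrability side conditions reduce to membership. *)
Definition bounded_mfun (f : T -> R) : Prop :=
  measurable_fun setT f /\ exists M : R, forall w, `|f w| <= M.

Definition mean f : R := \int[P]_w f w.

Lemma bounded_mfun_cst c : bounded_mfun (cst c).
Proof. by split; [exact: measurable_cst|exists `|c|]. Qed.

Lemma bounded_mfunD f g : bounded_mfun f -> bounded_mfun g ->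
  bounded_mfun (fun w => f w + g w).
Proof.
move=> [mf [M fM]] [mg [N gN]]; split; first exact: measurable_funD.
by exists (M + N) => w; rewrite (le_trans (ler_normD _ _))// lerD.
Qed.

Lemma bounded_mfunM f g : bounded_mfun f -> bounded_mfun g ->
  bounded_mfun (fun w => f w * g w).
Proof.
move=> [mf [M fM]] [mg [N gN]]; split; first exact: measurable_funM.
by exists (M * N) => w; rewrite normrM ler_pM.
Qed.

Lemma bounded_mfunZ c f : bounded_mfun f -> bounded_mfun (fun w => c * f w).
Proof. exact/bounded_mfunM/bounded_mfun_cst. Qed.

Lemma bounded_mfunB f g : bounded_mfun f -> bounded_mfun g ->
  bounded_mfun (fun w => f w - g w).
Proof.
move=> bf bg; rewrite (_ : (fun _ => _) = fun w => f w + -1 * g w).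
  by apply: bounded_mfunD => //; exact: bounded_mfunZ.
by apply/funext => w; rewrite mulN1r.
Qed.

Lemma bounded_mfunX f n : bounded_mfun f -> bounded_mfun (fun w => f w ^+ n).
Proof.
move=> bf; elim: n => [|n IH]; first exact: bounded_mfun_cst.
by under eq_fun do rewrite exprS; exact: bounded_mfunM.
Qed.

Lemma bounded_mfun_norm f : bounded_mfun f -> bounded_mfun (fun w => `|f w|).
Proof.
move=> [mf [M fM]]; split; first exact: measurableT_comp.
by exists M => w; rewrite normr_id.
Qed.

Lemma bounded_mfun_sum I (s : seq I) (p : pred I) (F : I -> T -> R) :
  (forall i, bounded_mfun (F i)) ->
  bounded_mfun (fun w => \sum_(i <- s | p i) F i w).
Proof.
move=> bF; elim: s => [|i s IH].
  by under eq_fun do rewrite big_nil; exact: bounded_mfun_cst.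
by under eq_fun do rewrite big_cons; case: (p i) => //; exact: bounded_mfunD.
Qed.

Lemma bounded_mfun_indic A : measurable A -> bounded_mfun (\1_A : T -> R).
Proof.
move=> mA; split; first exact: measurable_indic.
by exists 1 => w; rewrite indicE; case: (_ \in _); rewrite ?normr1 ?normr0.
Qed.

Lemma bounded_mfun_integrable f : bounded_mfun f ->
  P.-integrable setT (EFin \o f).
Proof.
move=> [mf [M fM]]; apply: measurable_bounded_integrable => //.
  by rewrite (le_lt_trans (probability_le1 P _))// ltry.
exists M; split; first exact: num_real.
by move=> N MN w _; apply: le_trans (fM w) (ltW MN).
Qed.

Lemma EFin_mean f : bounded_mfun f -> (mean f)%:E = (\int[P]_w (f w)%:E)%E.
Proof.
move=> bf; rewrite /mean /Rintegral fineK//.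
exact/integrable_fin_num/bounded_mfun_integrable.
Qed.

Lemma eq_mean f g : f =1 g -> mean f = mean g.
Proof. by move/funext->. Qed.

Lemma mean_cst c : mean (cst c) = c.
Proof.
by rewrite /mean Rintegral_cst// -[X in fine X]/(P setT) probability_setT mulr1.
Qed.

Lemma meanD f g : bounded_mfun f -> bounded_mfun g ->
  mean (fun w => f w + g w) = mean f + mean g.
Proof. by move=> bf bg; rewrite /mean RintegralD//; exact:
    bounded_mfun_integrable. Qed.

Lemma meanB f g : bounded_mfun f -> bounded_mfun g ->
  mean (fun w => f w - g w) = mean f - mean g.
Proof. by move=> bf bg; rewrite /mean RintegralB//; exact:
    bounded_mfun_integrable. Qed.

Lemma meanZ c f : bounded_mfun f -> mean (fun w => c * f w) = c * mean f.
Proof. by move=> bf; rewrite /mean RintegralZl//; exact: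
    bounded_mfun_integrable. Qed.

Lemma mean_sum I (s : seq I) (p : pred I) (F : I -> T -> R) :
  (forall i, bounded_mfun (F i)) ->
  mean (fun w => \sum_(i <- s | p i) F i w) = \sum_(i <- s | p i) mean (F i).
Proof.
move=> bF; elim: s => [|i s IH].
  by rewrite big_nil -[RHS](mean_cst 0); apply: eq_mean => w; rewrite big_nil.
rewrite big_cons -IH; case: ifPn => pi.
  rewrite -meanD//; last exact: bounded_mfun_sum.
  by apply: eq_mean => w; rewrite big_cons pi.
by apply: eq_mean => w; rewrite big_cons (negbTE pi).
Qed.

Lemma le_mean f g : bounded_mfun f -> bounded_mfun g ->
  (forall w, f w <= g w) -> mean f <= mean g.
Proof. by move=> bf bg fg; apply: le_Rintegral => //; exact:
    bounded_mfun_integrable. Qed.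

Lemma mean_ge0 f : (forall w, 0 <= f w) -> 0 <= mean f.
Proof. by move=> f0; exact: Rintegral_ge0. Qed.

Lemma ler_norm_mean f : bounded_mfun f -> `|mean f| <= mean (fun w => `|f w|).
Proof. by move=> bf; apply: le_normr_Rintegral => //; exact:
    bounded_mfun_integrable. Qed.

Lemma sqr_mean_le f : bounded_mfun f -> mean f ^+ 2 <= mean (fun w => f w ^+ 2).
Proof.
move=> bf; rewrite -subr_ge0; set m := mean f.
have -> : mean (fun w => f w ^+ 2) - m ^+ 2 = mean (fun w => (f w - m) ^+ 2).
  have -> : (fun w => (f w - m) ^+ 2) =
      (fun w => f w ^+ 2 + ((- 2 * m) * f w + m ^+ 2)).
    by apply/funext => w; ring.
  have b2 := bounded_mfunZ (- 2 * m) bf.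
  have bc := bounded_mfun_cst (m ^+ 2).
  rewrite meanD; [|exact: bounded_mfunX|exact: bounded_mfunD].
  by rewrite meanD// mean_cst meanZ// -/m; ring.
by apply: mean_ge0 => w; rewrite sqr_ge0.
Qed.

Lemma mean_indic A : measurable A -> mean \1_A = fine (P A).
Proof. by move=> mA; rewrite /mean /Rintegral integral_indic// setIT. Qed.

Lemma measurable_gt_norm f (c : R) : measurable_fun setT f ->
  measurable [set w | c < `|f w|].
Proof.
move=> mf; rewrite (_ : [set _ | _] = (fun w => `|f w|) @^-1` `]c,
    +oo[%classic).
  by rewrite -[X in measurable X]setTI; apply: measurableT_comp.
by apply/seteqP; split=> w /=; rewrite in_itv /= andbT.
Qed.

Lemma chebyshev_sqr f (c : R) : bounded_mfun f -> 0 < c ->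
  (P [set w | (c < `|f w|)%R] <= (mean (fun w => f w ^+ 2) / c ^+ 2)%:E)%E.
Proof.
move=> bf c0; have mA := measurable_gt_norm c bf.1; set A := [set _ | _] in mA
    *.
rewrite -[X in (X <= _)%E]fineK; last by rewrite fin_num_measure.
rewrite lee_fin ler_pdivlMr ?exprn_gt0// -mean_indic// mulrC -meanZ; last first.
  exact: bounded_mfun_indic.
apply: le_mean.
- exact/bounded_mfunZ/bounded_mfun_indic.
- exact: bounded_mfunX.
move=> w; rewrite indicE; case: (boolP (w \in A)) => [|_]; last by rewrite
    mulr0 sqr_ge0.
rewrite inE mulr1 => /= /ltW cf; rewrite -[leRHS]real_normK ?num_real//.
by rewrite ler_sqr ?nnegrE// ltW.
Qed.

End mean.

Lemma bounded_mfun_comp {d d1 : measure_display} {T : measurableType d}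
    {T1 : measurableType d1} {R : realType} (X : T -> T1) (g : T1 -> R) :
        measurable_fun setT X ->
  bounded_mfun g -> bounded_mfun (g \o X).
Proof.
by move=> mX [mg [M gM]]; split; [exact: measurableT_comp|exists M => w /=].
Qed.

Section mean_transfer.
Context {d d1 : measure_display} {T : measurableType d} {T1 : measurableType d1}
  {R : realType}.
Variable P : probability T R.

Lemma mean_distribution (X : {RV P >-> T1}) (Q : probability T1 R) (g : T1 ->
    R) :
  (forall A, measurable A -> distribution P X A = Q A) -> bounded_mfun g ->
  mean P (g \o X) = mean Q g.
Proof.
move=> PQ bg; have bgX := bounded_mfun_comp (@measurable_funPT _ _ _ _ X) bg.
apply: EFin_inj; rewrite !EFin_mean//.
transitivity (\int[distribution P X]_x (g x)%:E)%E; last first.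
  by apply: eq_measure_integral => A mA _; exact: PQ.
rewrite integral_distribution//; first by apply/measurable_EFinP; case: bg.
exact: (bounded_mfun_integrable P bgX).
Qed.

(** Independence on rectangles identifies the law of the pair with the product of the marginals, and
    Fubini factors the integral. *)
Lemma mean_indep (X1 X2 : {RV P >-> T1}) (f g : T1 -> R) :
  (forall A B, measurable A -> measurable B ->
     P (X1 @^-1` A `&` X2 @^-1` B) = (P (X1 @^-1` A) * P (X2 @^-1` B))%E) ->
  bounded_mfun f -> bounded_mfun g ->
  mean P (fun w => f (X1 w) * g (X2 w)) =
  mean P (f \o X1) * mean P (g \o X2).
Proof.
move=> ind bf bg.
have mX : measurable_fun setT (fun w => (X1 w, X2 w)).
  by apply/measurable_fun_pairP; split; exact: measurable_funPT.
pose h (z : T1 * T1) := f z.1 * g z.2.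
have bh : bounded_mfun h.
  have h1 : bounded_mfun (f \o @fst T1 T1) by exact: bounded_mfun_comp.
  have h2 : bounded_mfun (g \o @snd T1 T1) by exact: bounded_mfun_comp.
  exact: bounded_mfunM h1 h2.
pose m1 := distribution P X1; pose m2 := distribution P X2.
have ih : (m1 \x m2)%E.-integrable setT (EFin \o h).
  exact: bounded_mfun_integrable.
have -> : mean P (fun w => f (X1 w) * g (X2 w)) = fine (\int[(m1 \x m2)%E]_z (h
    z)%:E)%E.
  congr fine.
  transitivity (\int[pushforward P (fun w => (X1 w, X2 w))]_z (h z)%:E)%E.
    rewrite integral_pushforward//; first by apply/measurable_EFinP; case: bh.
    by apply: (bounded_mfun_integrable P); exact: bounded_mfun_comp mX bh.
  apply: eq_measure_integral => A mA _.
  apply/esym/product_measure_unique => // C D mC mD; exact: (ind C D mC mD).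
transitivity (mean m1 f * mean m2 g); last first.
  by congr (_ * _); apply/esym/mean_distribution.
rewrite -integral12_prod_meas1//= /fubini_F /=.
rewrite mulrC -meanZ//; congr fine; apply: eq_integral => x _.
rewrite mulrC -(meanZ _ (f x) bg) EFin_mean//.
exact: bounded_mfunZ.
Qed.

End mean_transfer.

(** * Concentration of averages over the extremes *)

Section top_k.
Context {R : realType}.

Lemma card_ord_lt_sum (n k : nat) : (k <= n)%N ->
  \sum_(i < n) (i < k)%N%:R = k%:R :> R.
Proof.
move=> kn; rewrite -natr_sum; congr (_%:R).
rewrite (eq_bigr (fun i : 'I_n => if (i < k)%N then 1%N else 0%N)); last first.
  by move=> i _; case: ltnP.
by rewrite -big_mkcond /= (big_ord_narrow kn) sum1_card card_ord.
Qed.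

Lemma top_k_sum_dist (n k : nat) (s : 'S_n) (x : 'I_n -> R) (f : 'I_n -> R)
    (t M : R) : (k <= n)%N -> (forall i, `|f i| <= M) ->
  (forall i j : 'I_n, (i <= j)%N -> x (s j) <= x (s i)) ->
  `|\sum_(i < n | (i < k)%N) f (s i) - \sum_(i < n) f i * (t < x i)%R%:R|
    <= M * `|k%:R - \sum_(i < n) (t < x i)%R%:R|.
Proof.
move=> kn fM xs.
pose b i : R := (t < x (s i))%R%:R; pose c (i : 'I_n) : R := (i < k)%N%:R.
have -> : \sum_(i < n) f i * (t < x i)%R%:R = \sum_(i < n) f (s i) * b i.
  by rewrite (reindex_inj (@perm_inj _ s)).
have -> : \sum_(i < n) (t < x i)%R%:R = \sum_(i < n) b i.
  by rewrite (reindex_inj (@perm_inj _ s)).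
have -> : k%:R = \sum_(i < n) c i by rewrite card_ord_lt_sum.
have -> : \sum_(i < n | (i < k)%N) f (s i) = \sum_(i < n) f (s i) * c i.
  rewrite big_mkcond; apply: eq_bigr => i _; rewrite /c.
  by case: ltnP; rewrite ?mulr1 ?mulr0.
rewrite -!sumrB.
(* If some observation exceeds the level without being among the first [k], then the first [k]
   dominate it and all exceed the level. *)
have mono : (forall i, b i <= c i) \/ (forall i, c i <= b i).
  have [[i bc]|/forallNP h] := pselect (exists i, ~ (b i <= c i)); last first.
    by left=> i; apply: contrapT; exact: h.
  right => j; move: bc; rewrite /b /c.
  case: (ltrP t (x (s i))) => [tx|_]; last by rewrite ler0n.
  case: (ltnP i k) => [_|ki _]; first by rewrite lexx.
  case: (ltnP j k) => [jk|_]; last by rewrite ler0n.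
  by rewrite (lt_le_trans tx)// xs// (leq_trans (ltnW jk)).
(* Terms of constant sign do not cancel, so the number of indices where the two selections differ is
   the difference of their cardinals. *)
have cb : \sum_i `|c i - b i| = `|\sum_(i < n) (c i - b i)|.
  case: mono => h.
    rewrite ger0_norm ?sumr_ge0// => [|i _]; last by rewrite subr_ge0.
    by apply: eq_bigr => i _; rewrite ger0_norm ?subr_ge0.
  rewrite ler0_norm ?sumr_le0// => [|i _]; last by rewrite subr_le0.
  by rewrite -sumrN; apply: eq_bigr => i _; rewrite ler0_norm ?subr_le0.
rewrite -cb mulr_sumr (le_trans (ler_norm_sum _ _ _))// ler_sum// => i _.
by rewrite -mulrBr normrM ler_wpM2r.
Qed.

End top_k.

(** * Deviation bounds for the average over the extremes *)

Section sample_concentration.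
Context {R : realType} {H : hilbertType R} {d : measure_display}
  {T : measurableType d}.
Variables (P : probability T R) (X : {RV P >-> borel H})
  (X_ : nat -> {RV P >-> borel H}) (sigma : forall n, T -> 'S_n).
Hypothesis X_iid : forall i (A : set (borel H)), measurable A ->
  distribution P (X_ i) A = distribution P X A.
Hypothesis X_indep : mutually_independent P (fun i => X_ i).
Hypothesis X_ord : norm_ordering (fun i => X_ i) sigma.
Implicit Types (psi : borel H -> R).

Lemma pairwise_indep i j (A B : set (borel H)) : i != j ->
  measurable A -> measurable B ->
  P (X_ i @^-1` A `&` X_ j @^-1` B) =
  (P (X_ i @^-1` A) * P (X_ j @^-1` B))%E.
Proof.
move=> ij mA mB; pose C k := if k == i then A else B.
have uij : uniq [:: i; j] by rewrite /= inE ij.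
have mC k : measurable (C k) by rewrite /C; case: ifP.
have := X_indep uij mC.
rewrite !big_cons big_nil mule1 /C eqxx eq_sym (negbTE ij) => <-.
congr (P _); apply/seteqP; split=> w.
  move=> [wA wB] k; rewrite /mkset in_cons mem_seq1 => /orP[] /eqP ->.
    by rewrite eqxx.
  by rewrite eq_sym (negbTE ij).
move=> h; split.
  by have := h i (mem_head _ _); rewrite eqxx.
have := h j; rewrite /mkset in_cons mem_seq1 eqxx orbT eq_sym (negbTE ij).
exact.
Qed.

Lemma mean_sample i psi : bounded_mfun psi -> mean P (psi \o X_ i) = mean P
    (psi \o X).
Proof.
move=> bpsi; rewrite (@mean_distribution _ _ _ _ _ P (X_ i) (distribution P
    X))//.
  by rewrite (@mean_distribution _ _ _ _ _ P X (distribution P X)).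
exact: X_iid.
Qed.

Lemma bounded_mfun_sample (Y : {RV P >-> borel H}) psi : bounded_mfun psi ->
  bounded_mfun (fun w => psi (Y w)).
Proof. by move=> bpsi; exact: (bounded_mfun_comp (@measurable_funPT _ _ _ _
    Y)). Qed.

(** Cross terms vanish by pairwise independence. The variance is bounded by the second moment
    because, for a function bounded by [M] and cut off at level [t], the latter is at most [M ^+ 2]
    times the tail probability. *)
Lemma sample_sum_variance psi n : bounded_mfun psi ->
  mean P (fun w => (\sum_(i < n) psi (X_ i w) - n%:R * mean P (psi \o X)) ^+ 2)
    <= n%:R * mean P (fun w => psi (X w) ^+ 2).
Proof.
move=> bpsi; set m := mean P (psi \o X).
pose c x := psi x - m.
have bc : bounded_mfun c by apply: bounded_mfunB => //; exact: bounded_mfun_cst.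
have cX (Y : {RV P >-> borel H}) : bounded_mfun (fun w => c (Y w)) by apply:
    bounded_mfun_sample.
have cXX (Y Z : {RV P >-> borel H}) : bounded_mfun (fun w => c (Y w) * c (Z w)).
  exact: bounded_mfunM.
have -> : (fun w => (\sum_(i < n) psi (X_ i w) - n%:R * m) ^+ 2) =
    (fun w => \sum_(i < n) \sum_(j < n) c (X_ i w) * c (X_ j w)).
  apply/funext => w; transitivity ((\sum_(i < n) c (X_ i w)) ^+ 2).
    by congr (_ ^+ 2); rewrite sumrB sumr_const card_ord mulr_natl.
  by rewrite expr2 mulr_suml; apply: eq_bigr => i _; rewrite mulr_sumr.
rewrite mean_sum; last by move=> i; exact: bounded_mfun_sum.
have c0 : mean P (c \o X) = 0.
  rewrite /comp /c meanB; [|exact: bounded_mfun_sample|exact: bounded_mfun_cst].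
  by rewrite mean_cst /m subrr.
have cc (i j : 'I_n) : mean P (fun w => c (X_ i w) * c (X_ j w)) =
    (i == j)%:R * mean P (fun w => c (X w) ^+ 2).
  have [->|ij] := eqVneq i j.
    rewrite mul1r -(mean_sample j (bounded_mfunX 2 bc)).
    by apply: eq_mean => w; rewrite /= expr2.
  rewrite (@mean_indep _ _ _ _ _ P (X_ i) (X_ j))//.
    by rewrite !mean_sample// c0 !mul0r.
  by move=> A B; apply: pairwise_indep.
under eq_bigr => i _.
  rewrite mean_sum//; under eq_bigr do rewrite cc.
  rewrite (bigD1 i)//= eqxx mul1r big1 ?addr0; last first.
    by move=> j; rewrite eq_sym => /negbTE ->; rewrite mul0r.
  over.
rewrite sumr_const card_ord mulr_natl lerMn2r; apply/orP; right.
have -> : mean P (fun w => c (X w) ^+ 2) =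
    mean P (fun w => psi (X w) ^+ 2) - m ^+ 2.
  have -> : (fun w => c (X w) ^+ 2) =
      (fun w => psi (X w) ^+ 2 - ((2 * m) * psi (X w) - m ^+ 2)).
    by apply/funext => w; rewrite /c; ring.
  have b2 := bounded_mfunZ (2 * m) (bounded_mfun_sample X bpsi).
  have bm := bounded_mfun_cst (T := T) (m ^+ 2).
  rewrite meanB; [|exact/bounded_mfunX/bounded_mfun_sample|exact:
      bounded_mfunB].
  rewrite meanB// mean_cst meanZ; last exact: bounded_mfun_sample.
  by rewrite -/(psi \o X) -/m; ring.
by rewrite gerBl sqr_ge0.
Qed.

(** The random permutation takes finitely many values, so an order statistic is a finite sum of
    sample terms weighted by the indicators of these values. *)
Lemma bounded_mfun_order_stat psi n (i : 'I_n) : bounded_mfun psi ->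
  bounded_mfun (fun w => psi (X_ (sigma n w i) w)).
Proof.
move=> bpsi; have -> : (fun w => psi (X_ (sigma n w i) w)) =
    (fun w => \sum_(s : 'S_n) \1_(sigma n @^-1` [set s]) w * psi (X_ (s i) w)).
  apply/funext => w; rewrite (bigD1 (sigma n w))//= big1 ?addr0.
    by rewrite indicE mem_set// mul1r.
  by move=> s /eqP sw; rewrite indicE memNset ?mul0r// => /= /esym.
apply: bounded_mfun_sum => s; apply: bounded_mfunM.
  by apply: bounded_mfun_indic; exact: (X_ord.1 n s).
exact: bounded_mfun_sample.
Qed.

Definition top_avg n k psi w : R :=
  k%:R^-1 * \sum_(i < n | (i < k)%N) psi (angle (X_ (sigma n w i) w)).

Lemma bounded_mfun_angle psi : bounded_mfun psi -> bounded_mfun (fun x : borel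
    H => psi (angle (x : H))).
Proof. exact: (bounded_mfun_comp measurable_angle). Qed.

Lemma bounded_mfun_top_avg n k psi : bounded_mfun psi -> bounded_mfun (top_avg
    n k psi).
Proof.
move=> bpsi; apply: bounded_mfunZ; apply: bounded_mfun_sum => i.
by apply: (bounded_mfun_order_stat (psi := fun x : borel H => psi (angle (x :
    H)))); exact: bounded_mfun_angle.
Qed.

Definition norm_gt (t : R) : set (borel H) := [set x | t < `|x|].

Lemma measurable_norm_gt t : measurable (norm_gt t).
Proof.
rewrite (_ : norm_gt t = [set x | t < `| `|x| |]); last first.
  by apply/seteqP; split => x /=; rewrite normr_id.
apply: measurable_gt_norm; apply: continuous_borel_measurable.
exact: norm_continuous.
Qed.

Lemma indic_norm_gt t (x : borel H) :
  \1_(norm_gt t) x = (t < `|x : H|)%R%:R :> R.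
Proof.
rewrite indicE; case: ltrP => h; first by rewrite mem_set.
by rewrite memNset//= /norm_gt /= ltNge h.
Qed.

Definition tail_mean t psi : R := mean P (fun w => psi (angle (X w)) *
    \1_(norm_gt t) (X w)).

Definition tail_prob t : R := fine (P [set w | t < `|X w|]).

Lemma tail_probE t : tail_prob t = mean P (\1_(norm_gt t) \o X).
Proof.
rewrite (_ : _ \o _ = \1_(X @^-1` norm_gt t)) ?mean_indic//.
by rewrite -[X in measurable X]setTI; apply: measurable_funPT => //; exact:
    measurable_norm_gt.
Qed.

(** The deviation splits into the fluctuation of the count, the fluctuation of the cut-off sum and a
    deterministic bias, each allotted [delta / 3]. Two Chebyshev bounds at level [k * delta / 3]
    give the constant 18 = 2 * 3^2. *)
Lemma top_avg_concentration n k t psi (M L delta : R) : bounded_mfun psi ->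
  (forall x, `|x| <= 1 -> `|psi x| <= M) -> (1 <= k <= n)%N -> 0 < delta ->
  M * `|n%:R * tail_prob t / k%:R - 1| + `|n%:R * tail_mean t psi / k%:R - L|
    <= delta / 3 ->
  (P [set w | (delta < `|top_avg n k psi w - L|)%R] <=
    (18 * M ^+ 2 * (n%:R * tail_prob t / k%:R) / k%:R / delta ^+ 2)%:E)%E.
Proof.
move=> bpsi psiM /andP[k1 kn] delta0 hL.
have k0 : 0 < k%:R :> R by rewrite ltr0n.
have M0 : 0 <= M.
  by apply: le_trans (psiM 0 _); rewrite ?normr_ge0// normr0.
have b1 : bounded_mfun (\1_(norm_gt t) : borel H -> R).
  exact: bounded_mfun_indic (measurable_norm_gt t).
pose f (x : borel H) := psi (angle (x : H)) * \1_(norm_gt t) x.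
have bf : bounded_mfun f by apply: bounded_mfunM => //; exact:
    bounded_mfun_angle.
pose N w := \sum_(i < n) (\1_(norm_gt t) (X_ i w) : R).
pose S w := \sum_(i < n) f (X_ i w).
pose dN w := M * (N w - n%:R * tail_prob t).
pose dS w := S w - n%:R * tail_mean t psi.
have bsum (g : borel H -> R) : bounded_mfun g -> bounded_mfun (fun w => \sum_(i
    < n) g (X_ i w)).
  by move=> bg; apply: bounded_mfun_sum => i; exact: bounded_mfun_sample.
have bdN : bounded_mfun dN.
  by apply: bounded_mfunZ; apply: bounded_mfunB; [exact: bsum|exact:
      bounded_mfun_cst].
have bdS : bounded_mfun dS.
  by apply: bounded_mfunB; [exact: bsum|exact: bounded_mfun_cst].
have V0 : 0 <= tail_prob t by exact: fine_ge0.
have ind2 x : (\1_(norm_gt t) x : R) ^+ 2 = \1_(norm_gt t) x.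
  by rewrite indicE; case: (_ \in _); rewrite ?expr1n ?expr0n.
have vN : mean P (fun w => dN w ^+ 2) <= M ^+ 2 * (n%:R * tail_prob t).
  have -> : (fun w => dN w ^+ 2) =
      (fun w => M ^+ 2 * (N w - n%:R * tail_prob t) ^+ 2).
    by apply/funext => w; rewrite /dN exprMn.
  rewrite meanZ; last first.
    by apply: bounded_mfunX; apply: bounded_mfunB; [exact: bsum|exact:
        bounded_mfun_cst].
  rewrite ler_wpM2l ?sqr_ge0//.
  have := sample_sum_variance n b1; rewrite -tail_probE => /le_trans; apply.
  rewrite tail_probE ler_wpM2l ?ler0n// le_eqVlt; apply/orP; left; apply/eqP.
  by apply: eq_mean => w /=; exact: ind2.
have vS : mean P (fun w => dS w ^+ 2) <= M ^+ 2 * (n%:R * tail_prob t).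
  apply: le_trans (sample_sum_variance n bf) _.
  rewrite mulrCA ler_wpM2l ?ler0n// tail_probE -meanZ; last exact:
      bounded_mfun_sample.
  apply: le_mean.
  - exact/bounded_mfunX/bounded_mfun_sample.
  - exact/bounded_mfunZ/bounded_mfun_sample.
  move=> w; rewrite exprMn ind2 ler_wpM2r//.
  rewrite -[leLHS]real_normK ?num_real// ler_sqr ?nnegrE//.
  exact/psiM/norm_angle_le1.
pose c := k%:R * delta / 3.
have c0 : 0 < c by rewrite /c !mulr_gt0 ?invr_gt0.
have incl w : delta < `|top_avg n k psi w - L| -> c < `|dN w| \/ c < `|dS w|.
  move=> h; apply: contrapT => /not_orP[/negP + /negP]; rewrite -!leNgt => hN
      hS.
  move: h; apply/negP; rewrite -leNgt.
  have /= top := @top_k_sum_dist R n k (sigma n w) (fun i => `|X_ i w|)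
    (fun i => psi (angle (X_ i w : H))) t M kn
    (fun i => psiM _ (norm_angle_le1 _)) (X_ord.2 n w).
  set U := \sum_(i < n | _) _ in top.
  have -> : top_avg n k psi w = k%:R^-1 * U by [].
  have eN : \sum_(i < n) (t < `|X_ i w : H|)%R%:R = N w.
    by apply: eq_bigr => i _; rewrite indic_norm_gt.
  have eS : \sum_(i < n) psi (angle (X_ i w : H)) * (t < `|X_ i w : H|)%R%:R =
      S w.
    by apply: eq_bigr => i _; rewrite /f indic_norm_gt.
  rewrite eN eS in top.
  have top2 : `|U - S w| <= `|dN w| + M * `|n%:R * tail_prob t - k%:R|.
    apply: le_trans top _; rewrite normrM (ger0_norm M0) -mulrDr ler_wpM2l//.
    rewrite [leLHS]distrC.
    by apply: le_trans (ler_normD _ _); rewrite addrA subrK.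
  rewrite -(ler_pM2l k0) -[X in X * `|_|](ger0_norm (ltW k0)) -normrM mulrBr
      mulrA.
  rewrite divff ?gt_eqF// mul1r.
  have hL2 : M * `|n%:R * tail_prob t - k%:R| + `|n%:R * tail_mean t psi - k%:R
      * L| <= c.
    have -> : n%:R * tail_prob t - k%:R = k%:R * (n%:R * tail_prob t / k%:R -
        1).
      by field; rewrite gt_eqF.
    have -> : n%:R * tail_mean t psi - k%:R * L = k%:R * (n%:R * tail_mean t
        psi / k%:R - L).
      by field; rewrite gt_eqF.
    rewrite !normrM !(ger0_norm (ltW k0)) mulrCA -mulrDr.
    by have -> : c = k%:R * (delta / 3); [rewrite /c mulrA|rewrite ler_pM2l].
  have -> : U - k%:R * L = (U - S w) + dS w + (n%:R * tail_mean t psi - k%:R *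
      L).
    by rewrite /dS; ring.
  rewrite (le_trans (ler_normD _ _))// (le_trans (lerD (ler_normD _ _) (lexx
      _)))//.
  have ec : k%:R * delta = 3 * c by rewrite /c; field.
  rewrite ec; lra.
have mN := measurable_gt_norm c bdN.1; have mS := measurable_gt_norm c bdS.1.
have mtop : measurable [set w | delta < `|top_avg n k psi w - L|].
  apply: (measurable_gt_norm delta (f := fun w => top_avg n k psi w - L)).
  have [] // := bounded_mfunB (bounded_mfun_top_avg n k bpsi) (bounded_mfun_cst
      L).
apply: (@le_trans _ _ (P ([set w | c < `|dN w|] `|` [set w | c < `|dS w|]))).
  by apply: le_measure; rewrite ?inE//; exact: measurableU.
apply: (le_trans (measureU2 _ _ _)) => //.
apply: (le_trans (leeD (chebyshev_sqr P bdN c0) (chebyshev_sqr P bdS c0))).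
rewrite -EFinD lee_fin -mulrDl ler_pdivrMr ?exprn_gt0//.
have -> : 18 * M ^+ 2 * (n%:R * tail_prob t / k%:R) / k%:R / delta ^+ 2 * c ^+
    2 =
    2 * (M ^+ 2 * (n%:R * tail_prob t)).
  by rewrite /c; field; rewrite !gt_eqF.
lra.
Qed.

End sample_concentration.

(** * Integrals against set functions *)

Section integral_set_function.
Context {d : measure_display} {T : measurableType d} {R : realType}.
Implicit Types (m : set T -> \bar R) (D : set T) (f : T -> \bar R).
Import HBNNSimple.

(* The integrals in [M0_cvg] and [limit_angular_measure] are taken against bare
   set functions, possibly negative ones in the first case. *)
Lemma eq_sintegral_below m1 m2 D f (h : {nnsfun T >-> R}) :
  (forall A, measurable A -> A `<=` D -> m1 A = m2 A) ->
  (forall x, (h x)%:E <= (f \_ D) x)%E -> sintegral m1 h = sintegral m2 h.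
Proof.
move=> m12 hf; apply: eq_fsbigr => r _.
(* Level 0 is cancelled by its factor, whatever the set function does there; every other level that
   is attained lies inside [D]. *)
have [->|r0] := eqVneq r 0; first by rewrite !mul0e.
congr (_ * _)%E; apply: m12; first exact: measurable_sfunP.
move=> x /= hx; apply: contrapT => Dx; have := hf x.
rewrite patchE memNset// hx lee_fin => r_le0.
by move: r0; rewrite eq_le r_le0 -hx fun_ge0.
Qed.

Lemma eq_set_function_integral m1 m2 D f :
  (forall A, measurable A -> A `<=` D -> m1 A = m2 A) ->
  (\int[m1]_(x in D) f x = \int[m2]_(x in D) f x)%E.
Proof.
move=> m12; rewrite /integral funepos_restrict funeneg_restrict.
have m21 A : measurable A -> A `<=` D -> m2 A = m1 A by move=> *; rewrite m12.
by congr (ereal_sup _ - ereal_sup _)%E; apply/seteqP; split=> _ [h hf <-];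
  exists h => //; first [exact: eq_sintegral_below m21 hf|exact:
      eq_sintegral_below m12 hf].
Qed.

(** The integral is a difference of two suprema over simple functions: the first is at most 0, and
    the zero simple function makes the second at least 0. This serves to exclude nonpositive values
    of b(n). *)
Lemma integral_nonpos_set_function m D f : m set0 = 0%E ->
  (forall A, measurable A -> (m A <= 0)%E) -> (forall x, D x -> (0 <= f x)%E) ->
  (\int[m]_(x in D) f x <= 0)%E.
Proof.
move=> m0 mle0 f0; rewrite /integral.
(* A simple integral ranges over all real levels; the negative ones have empty preimage, whence the
   assumption on [m set0]. *)
have h0 (r : R) (h : {nnsfun T >-> R}) : (r < 0)%R -> h @^-1` [set r] = set0.
  by move=> r0; exact: preimage_nnfun0.
rewrite -[leRHS](subee (x := 0%E))//; apply: leeB.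
  apply: ge_ereal_sup => _ [h _ <-]; rewrite /sintegral.
  apply: (big_ind (fun x => (x <= 0)%E)) => // [x y x0 y0|r _]; first exact:
      adde_le0.
  have [r0|r0] := ltP r 0; first by rewrite h0// m0 mule0.
  by rewrite mule_ge0_le0//; exact: mle0.
apply: ereal_sup_ubound; exists nnsfun0.
  by move=> x /=; rewrite funeneg_ge0.
rewrite /sintegral fsbig1// => r _; have [->|r0] := eqVneq r 0%R; first by
    rewrite mul0e.
rewrite (_ : _ @^-1` _ = set0) ?m0 ?mule0//.
by apply/seteqP; split=> // x /= e; move: r0; rewrite -e eqxx.
Qed.

End integral_set_function.

(** * Limit of the angular law *)

Section angular_limit.
Context {R : realType} {H : hilbertType R} {d : measure_display}
  {T : measurableType d}.
Variables (P : probability T R) (X : {RV P >-> borel H}).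
Implicit Types (t : R) (psi : borel H -> R).

(* 0 is not on the unit sphere, so on subsets of the sphere the law of
   [angle_above t X] is the unnormalized [angle_law_above]. *)
Definition angle_above t (x : borel H) : borel H :=
  if (t < `|x : H|)%R then angle (x : H) else (0 : H).

Lemma measurable_angle_above t : measurable_fun setT (angle_above t).
Proof.
apply: measurable_fun_if => //.
- have := continuous_borel_measurable (@norm_continuous _ H).
  by move=> /(measurable_fun_ltr (measurable_cst t)).
- by apply: measurable_funS measurable_angle.
Qed.

Lemma measurable_above t : measurable [set w | t < `|X w : H|].
Proof.
rewrite -[X in measurable X]setTI.
exact: (@measurable_funPT _ _ _ _ X _ _ (measurable_norm_gt t)).
Qed.

Lemma tail_prob_ge0 t : 0 <= tail_prob X t.
Proof. exact: fine_ge0. Qed.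

Lemma EFin_tail_prob t : (tail_prob X t)%:E = P [set w | t < `|X w : H|].
Proof. by rewrite fineK// fin_num_measure//; exact: measurable_above. Qed.

Lemma tail_prob_nonincreasing : {homo tail_prob X : s t /~ s <= t}.
Proof.
move=> s t st; rewrite -lee_fin !EFin_tail_prob le_measure ?inE//.
- exact: measurable_above.
- exact: measurable_above.
by move=> w /=; exact: le_lt_trans.
Qed.

Lemma bounded_mfun_tail t psi : bounded_mfun psi ->
  bounded_mfun (fun w => psi (angle (X w)) * \1_(norm_gt t) (X w)).
Proof.
move=> bpsi; apply: (@bounded_mfun_sample _ _ _ _ P X
  (fun x => psi (angle (x : H)) * \1_(norm_gt t) x)).
apply: bounded_mfunM; first exact: bounded_mfun_angle.
exact: bounded_mfun_indic (measurable_norm_gt t).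
Qed.

(** On subsets of the sphere the conditional law agrees with a rescaled image of [P] under
    [angle_above], which is a genuine measure. As [t >= 0], an observation of norm above [t] is
    nonzero and its angle has norm 1. *)
Lemma integral_angle_law_above t psi : 0 <= t -> bounded_mfun psi ->
  (forall x, 0 <= psi x) ->
  (\int[angle_law_above P X t]_(x in unit_sphere) (psi x)%:E)%E =
  (tail_mean X t psi / tail_prob X t)%:E.
Proof.
move=> t0 bpsi psi0; have mpsi : measurable_fun setT (EFin \o psi).
  by apply/measurable_EFinP; case: bpsi.
have mS := @measurable_unit_sphere R H.
pose Y := angle_above t \o X.
have mY : measurable_fun setT Y.
  by apply: measurableT_comp; [exact: measurable_angle_above|exact:
      measurable_funPT].
have c0 : 0 <= (tail_prob X t)^-1 by rewrite invr_ge0 tail_prob_ge0.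
rewrite (@eq_set_function_integral _ _ _ _ (mscale (NngNum c0) (pushforward P
    Y))).
  rewrite ge0_integral_mscale//; [|exact: measurable_funTS|by move=> x _;
      rewrite lee_fin].
  rewrite ge0_integral_pushforward//; [|exact: measurable_funTS|by move=> x _;
      rewrite lee_fin].
  rewrite mulrC EFinM EFin_mean; last exact: bounded_mfun_tail.
  congr (_ * _)%E; rewrite integral_mkcond; apply: eq_integral => w _.
  rewrite patchE indic_norm_gt /Y /= /angle_above; case: ltrP => tX.
    have X0 : (X w : H) != 0 by rewrite -normr_gt0 (le_lt_trans t0).
    by rewrite mem_set ?mulr1//= /angle_above tX; exact: norm_angle.
  rewrite memNset ?mulr0//= /unit_sphere /= /angle_above ltNge tX /= normr0.
  by apply/eqP; rewrite eq_sym oner_eq0.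
move=> A mA AS; rewrite /angle_law_above /mscale /= /pushforward muleC.
congr (_ * P _)%E; apply/seteqP; split => w /=; rewrite /Y /= /angle_above.
  by move=> [Aw ->].
case: ifP => // tX /AS; rewrite /unit_sphere /= normr0 => /eqP.
by rewrite eq_sym oner_eq0.
Qed.

Variable Q : probability (borel H) R.
Hypothesis XQ : limit_angular_measure P X Q.

Lemma mean_unit_sphere psi : bounded_mfun psi ->
  (\int[Q]_(x in unit_sphere) (psi x)%:E)%E = (mean Q psi)%:E.
Proof.
move=> bpsi; rewrite EFin_mean//.
have ip := bounded_mfun_integrable Q bpsi.
have mS := @measurable_unit_sphere R H.
rewrite (negligible_integral (measurableC mS) measurableT ip) ?setTD ?setCK//.
have /= -> := probability_setC Q mS; have /= -> := XQ.1.
by rewrite subee.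
Qed.

Lemma tail_mean_cvg psi : continuous (psi : H -> R) -> bounded_mfun psi ->
  (forall x, 0 <= psi x) ->
  tail_mean X t psi / tail_prob X t @[t --> +oo] --> mean Q psi.
Proof.
move=> cpsi bpsi psi0.
have : (\int[angle_law_above P X t]_(x in unit_sphere) (psi x)%:E)%E
    @[t --> +oo] --> (mean Q psi)%:E.
  rewrite -mean_unit_sphere//; apply: XQ.2; first exact: continuous_subspaceT.
  by case: bpsi => _ [M psiM]; exists M => x _; exact: psiM.
move=> /fine_cvg; apply: cvg_trans; apply: near_eq_cvg.
near=> t; have t0 : 0 <= t by near: t; exact: (nbhs_pinfty_ge (num_real 0)).
by rewrite /= integral_angle_law_above.
Unshelve. all: by end_near. Qed.

(** If the tail vanished at [t] it would vanish beyond, and the ratios for the constant function 1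
    would be 0 by the convention on inverses, whereas they converge to 1. *)
Lemma tail_prob_gt0 t : 0 < tail_prob X t.
Proof.
have := @tail_mean_cvg (cst 1) (@cst_continuous _ _ _) (bounded_mfun_cst 1)
    (fun=> ler01).
rewrite mean_cst => /cvgr_gt/(_ 0 ltr01) h.
have [s [st]] : exists s, t <= s /\ 0 < tail_mean X s (cst 1) / tail_prob X s.
  near (+oo : set_system R) => s; exists s; split; last by near: s.
  by near: s; exact: (nbhs_pinfty_ge (num_real t)).
rewrite !lt_neqAle tail_prob_ge0 andbT => /andP[+ _]; apply: contra => /eqP Vt.
have -> : tail_prob X s = 0.
  apply/eqP; rewrite eq_le tail_prob_ge0 andbT Vt.
  exact: tail_prob_nonincreasing.
by rewrite invr0 mulr0.
Unshelve. all: by end_near. Qed.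

Lemma tail_prob_cvg0 : tail_prob X n%:R @[n --> \oo] --> (0 : R).
Proof.
have mA (n : nat) := measurable_above n%:R.
have : (P \o (fun n : nat => [set w | n%:R < `|X w : H|])) n @[n --> \oo] -->
    P (\bigcap_n [set w | n%:R < `|X w : H|]).
  apply: nonincreasing_cvg_mu => //.
  - by rewrite (le_lt_trans (probability_le1 _ _)) ?ltry.
  - exact: bigcapT_measurable.
  move=> m n mn; apply/subsetPset => w /=; apply: le_lt_trans.
  by rewrite ler_nat.
rewrite (_ : \bigcap_n _ = set0) ?measure0; last first.
  apply/seteqP; split=> // w /= h.
  have := h (Num.truncn `|X w : H|).+1 I; rewrite /= ltNge ltW//.
  exact: truncnS_gt.
exact: fine_cvg.
Qed.

End angular_limit.

(** * Regular variation of the tail *)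

Section tail_ratio.
Context {R : realType} {H : hilbertType R} {d : measure_display}
  {T : measurableType d}.
Variables (P : probability T R) (X : {RV P >-> borel H}).

(** For [a < b], a continuous function between the indicators of norm at least [b] and of norm
    greater than [a]: an admissible test function that replaces a tail set. *)
Definition ramp (a b : R) (x : borel H) : R :=
  Num.min 1 (Num.max 0 ((`|x : H| - a) / (b - a))).

Lemma ramp_ge0 a b x : 0 <= ramp a b x.
Proof. by rewrite /ramp le_min ler01 le_max lexx. Qed.

Lemma ramp_le1 a b x : ramp a b x <= 1.
Proof. by rewrite /ramp ge_min lexx. Qed.

Lemma continuous_ramp a b : continuous (ramp a b : H -> R).
Proof.
have cu : continuous (fun x : H => (`|x| - a) / (b - a)).
  move=> x; apply: cvgM; last exact: cvg_cst.
  by apply: cvgB; [exact: norm_continuous|exact: cvg_cst].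
have c0 : continuous (fun x : H => Num.max 0 ((`|x| - a) / (b - a))).
  move=> x; apply: (@continuous_max _ _ (cst 0) (fun x : H => (`|x| - a) / (b -
      a))).
    exact: cst_continuous.
  exact: cu.
move=> x; apply: (@continuous_min _ _ (cst 1) (fun x : H => Num.max 0 _)).
  exact: cst_continuous.
exact: c0.
Qed.

Lemma ramp_eq0 a b (x : H) : a < b -> `|x| <= a -> ramp a b x = 0.
Proof.
move=> ab xa; rewrite /ramp max_l ?min_r ?ler01//.
by rewrite ler_pdivrMr ?subr_gt0// mul0r subr_le0.
Qed.

Lemma ramp_eq1 a b (x : H) : a < b -> b <= `|x| -> ramp a b x = 1.
Proof.
move=> ab xb; rewrite /ramp min_l// le_max; apply/orP; right.
by rewrite ler_pdivlMr ?subr_gt0// mul1r lerB.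
Qed.

Lemma C0_ramp a b : 0 < a -> a < b -> C0 (ramp a b : H -> R).
Proof.
move=> a0 ab; split.
- exact/continuous_subspaceT/continuous_ramp.
- by exists 1 => x _; rewrite ger0_norm ?ramp_ge0 ?ramp_le1.
- by exists a => // x _ xa; rewrite ramp_eq0// ltW.
Qed.

Lemma bounded_mfun_ramp a b : bounded_mfun (ramp a b).
Proof.
split; first by apply: continuous_borel_measurable; exact: continuous_ramp.
by exists 1 => x; rewrite ger0_norm ?ramp_ge0 ?ramp_le1.
Qed.

Lemma measurable_scale (c : R) : measurable_fun setT (fun w => c *: (X w : H) :
    borel H).
Proof.
apply: (@measurableT_comp _ _ _ _ _ _ (fun x : borel H => c *: (x : H) : borel
    H)).
  by apply: continuous_borel_borel_measurable; exact: scaler_continuous.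
exact: measurable_funPT.
Qed.

Definition scaled_law (b : R -> R) (n : nat) (A : set (borel H)) : \bar R :=
  ((b n%:R)%:E * P (X @^-1` dilate n%:R A))%E.

Lemma dilateE (t : R) (A : set H) (x : H) : t != 0 -> dilate t A x <-> A (t^-1
    *: x).
Proof.
move=> t0; split=> [[y Ay <-]|Ax]; first by rewrite scalerA mulVf// scale1r.
by exists (t^-1 *: x) => //; rewrite scalerA divff// scale1r.
Qed.

(** The vector [X w] lies in the dilation of [A] by [n] when [X w / n] lies in [A], so for
    [b n >= 0] the set function is a multiple of the law of [X / n]. *)
Lemma integral_scaled_law_ramp (b : R -> R) n r s : (0 < n)%N -> 0 < r -> r < s
    ->
  0 <= b n%:R ->
  (\int[scaled_law b n]_(x in punctured) (ramp r s x)%:E)%E =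
  (b n%:R * mean P (fun w => ramp r s (n%:R^-1 *: (X w : H))))%:E.
Proof.
move=> n0 r0 rs bn; have nz : n%:R != 0 :> R by rewrite pnatr_eq0 -lt0n.
have mf : measurable_fun setT (EFin \o ramp r s).
  by apply/measurable_EFinP; case: (bounded_mfun_ramp r s).
have mp := @measurable_punctured R H.
pose Y := (fun w => n%:R^-1 *: (X w : H)) : T -> borel H.
have mY : measurable_fun setT Y by exact: measurable_scale.
rewrite (@eq_set_function_integral _ _ _ _ (mscale (NngNum bn) (pushforward P
    Y))).
  rewrite ge0_integral_mscale//; [|exact: measurable_funTS|by move=> x _;
      rewrite lee_fin ramp_ge0].
  rewrite ge0_integral_pushforward//; [|exact: measurable_funTS|by move=> x _;
      rewrite lee_fin ramp_ge0].
  rewrite EFinM EFin_mean; last exact: (bounded_mfun_comp mY (bounded_mfun_ramp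
      r s)).
  congr (_ * _)%E; rewrite integral_mkcond; apply: eq_integral => w _.
  rewrite patchE; case: ifPn => // /negP; rewrite in_setE /= /punctured /= => h.
  have -> : n%:R^-1 *: (X w : H) = 0 by apply: contrapT.
  by rewrite ramp_eq0// normr0 ltW.
move=> A mA _; rewrite /scaled_law /mscale /= /pushforward.
by congr (_ * P _)%E; apply/seteqP; split=> w /=; rewrite dilateE.
Qed.

Lemma integral_scaled_law_ramp_le0 (b : R -> R) n r s : (0 < n)%N ->
  b n%:R <= 0 -> (\int[scaled_law b n]_(x in punctured) (ramp r s x)%:E <= 0)%E.
Proof.
move=> n0 bn; apply: integral_nonpos_set_function.
- rewrite /scaled_law (_ : X @^-1` _ = set0) ?measure0 ?mule0//.
  by apply/seteqP; split=> // w /= [].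
- by move=> A mA; rewrite /scaled_law mule_le0_ge0.
- by move=> x _; rewrite lee_fin ramp_ge0.
Qed.

Lemma bounded_mfun_above t : bounded_mfun (\1_(norm_gt t) \o X : T -> R).
Proof.
apply: (@bounded_mfun_sample _ _ _ _ P X (\1_(norm_gt t))).
exact: bounded_mfun_indic (measurable_norm_gt t).
Qed.

Lemma tail_prob_le_ramp (n : nat) a b : (0 < n)%N -> a < b ->
  tail_prob X (n%:R * b) <= mean P (fun w => ramp a b (n%:R^-1 *: (X w : H))).
Proof.
move=> n0 ab; have nz : 0 < n%:R :> R by rewrite ltr0n.
rewrite tail_probE; apply: le_mean.
- exact: bounded_mfun_above.
- exact: (bounded_mfun_comp (measurable_scale _) (bounded_mfun_ramp a b)).
move=> w /=; rewrite indic_norm_gt; case: ltrP => h; last exact: ramp_ge0.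
rewrite ramp_eq1// normrZ ger0_norm ?invr_ge0 ?ler0n// mulrC ler_pdivlMr//.
by rewrite mulrC ltW.
Qed.

Lemma ramp_le_tail_prob (n : nat) a b : (0 < n)%N -> a < b ->
  mean P (fun w => ramp a b (n%:R^-1 *: (X w : H))) <= tail_prob X (n%:R * a).
Proof.
move=> n0 ab; have nz : 0 < n%:R :> R by rewrite ltr0n.
rewrite tail_probE; apply: le_mean.
- exact: (bounded_mfun_comp (measurable_scale _) (bounded_mfun_ramp a b)).
- exact: bounded_mfun_above.
move=> w /=; rewrite indic_norm_gt; case: ltrP => h; first exact: ramp_le1.
rewrite ramp_eq0// normrZ ger0_norm ?invr_ge0 ?ler0n// mulrC ler_pdivrMr//.
by rewrite mulrC.
Qed.

Section limit_measure.
Variables (mu : {measure set (borel H) -> \bar R}) (alpha : R).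
Hypothesis mu0 : M0 mu.
Hypothesis mu_neq0 : mu punctured <> 0%E.
Hypothesis mu_homo : forall (t : R) (A : set (borel H)), 0 < t -> measurable A
    ->
  A `<=` punctured -> mu (dilate t A) = ((t `^ (- alpha))%:E * mu A)%E.

Let G r := fine (mu (norm_gt r)).

Lemma norm_gt_punctured (r : R) : 0 <= r -> @norm_gt R H r `<=` punctured.
Proof. by move=> r0 x; rewrite /norm_gt /= => /(le_lt_trans r0); rewrite
    normr_gt0 => /eqP. Qed.

Lemma EFin_mu_norm_gt r : 0 < r -> mu (norm_gt r) = (G r)%:E.
Proof.
move=> r0; rewrite fineK// ge0_fin_numE//; apply: mu0.
- exact: measurable_norm_gt.
- exact/norm_gt_punctured/ltW.
- by exists r => // x /ltW.
Qed.

Lemma mu_norm_gt_homo r : 0 < r -> G r = r `^ (- alpha) * G 1.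
Proof.
move=> r0; apply: EFin_inj; rewrite -EFin_mu_norm_gt// EFinM -EFin_mu_norm_gt//.
rewrite -mu_homo//; [|exact: measurable_norm_gt|exact: norm_gt_punctured].
congr (mu _); apply/seteqP; split=> x /=; rewrite dilateE ?gt_eqF// /norm_gt /=
  normrZ ger0_norm ?invr_ge0 ?ltW// mulrC ltr_pdivlMr// mul1r //.
Qed.

(** By homogeneity [G 1 = 0] would annihilate every set of norm greater than some [r > 0], and
    countably many of these cover the punctured space. *)
Lemma mu_norm_gt1 : 0 < G 1.
Proof.
rewrite lt_neqAle fine_ge0// andbT; apply/eqP => G1; apply: mu_neq0.
have -> : punctured = \bigcup_n (@norm_gt R H n.+1%:R^-1).
  apply/seteqP; split => [x /eqP|x [n _]]; last exact: norm_gt_punctured.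
  rewrite -normr_gt0 => x0.
  near \oo => n; exists n => //; rewrite /norm_gt /=.
  near: n; exact: near_infty_natSinv_lt (PosNum x0).
apply/eqP; rewrite eq_le measure_ge0 andbT.
apply: (@le_trans _ _ (\sum_(0 <= n <oo) mu (norm_gt n.+1%:R^-1))%E).
  apply: measure_sigma_subadditive => // [n|]; first exact: measurable_norm_gt.
  by apply: bigcupT_measurable => n; exact: measurable_norm_gt.
rewrite eseries0// => n _ _.
by rewrite EFin_mu_norm_gt ?invr_gt0// mu_norm_gt_homo ?invr_gt0// -G1 mulr0.
Unshelve. all: by end_near. Qed.

Definition mu_ramp a b : \bar R := (\int[mu]_(x in punctured) (ramp a b
    x)%:E)%E.

Lemma mu_ramp_bounds a b : 0 < a -> a < b -> ((G b)%:E <= mu_ramp a b <= (G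
    a)%:E)%E.
Proof.
move=> a0 ab; have b0 := lt_trans a0 ab.
have mp := @measurable_punctured R H.
have mr : measurable_fun setT (EFin \o ramp a b).
  by apply/measurable_EFinP; case: (bounded_mfun_ramp a b).
have mI r : measurable_fun setT (fun x : borel H => (\1_(norm_gt r) x)%:E :
    \bar R).
  by apply/measurable_EFinP; apply: measurable_indic; exact: measurable_norm_gt.
have GE r : 0 < r -> (\int[mu]_(x in punctured) (\1_(norm_gt r) x)%:E)%E = (G
    r)%:E.
  move=> r0; rewrite integral_indic//; last exact: measurable_norm_gt.
  by rewrite setIidl ?EFin_mu_norm_gt//; exact/norm_gt_punctured/ltW.
rewrite -!GE//; apply/andP; split; apply: ge0_le_integral => //;
  try exact: measurable_funTS.
- by move=> x _; rewrite lee_fin indic_norm_gt; case: ltrP => // h;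
    rewrite ?ramp_ge0// ramp_eq1// ltW.
- by move=> x _; rewrite lee_fin ramp_ge0.
- by move=> x _; rewrite lee_fin indic_norm_gt; case: ltrP => // h;
    rewrite ?ramp_le1// ramp_eq0.
Qed.

End limit_measure.
End tail_ratio.

(** * Levels matched to the number of extremes *)

Section thresholds.
Context {R : realType} {H : hilbertType R} {d : measure_display}
  {T : measurableType d}.
Variables (P : probability T R) (X : {RV P >-> borel H}).

(** Ramps over [c^2, c] and [1, 1/c] compare the tail at [n * c] with the tail at [n]. Their limits
    are at most G(c^2) and at least G(1/c), whose ratio is the power -3 alpha of c; the unknown
    factor b(n) cancels. *)
Lemma tail_prob_ratio (alpha eta : R) : regularly_varying P X alpha -> 0 < eta
    ->
  \forall n \near \oo, tail_prob X n%:R <= (1 + eta) * tail_prob X n.+1%:R.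
Proof.
move=> [alpha0 [mu [b [[mu0 mu_neq0] _ cvgmu mu_homo]]]] eta0.
(* Chosen so that the power -3 alpha of [c] is [1 + eta / 2]; the strict gap below [1 + eta] lets
   the limit inequality hold for large [n]. *)
pose c := (1 + eta / 2) `^ (- (3 * alpha)^-1).
have e1 : 1 < 1 + eta / 2 by rewrite ltrDl divr_gt0.
have e0 : 0 < 1 + eta / 2 by rewrite (lt_trans ltr01).
have c0 : 0 < c by rewrite powR_gt0.
have a3 : 0 < 3 * alpha by rewrite mulr_gt0.
have c1 : c < 1.
  rewrite /c powRN invf_lt1 ?powR_gt0//.
  have : 1 `^ (3 * alpha)^-1 < (1 + eta / 2) `^ (3 * alpha)^-1.
    by apply: gt0_ltr_powR; rewrite ?invr_gt0// nnegrE ?ler01// ltW.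
  by rewrite powR1.
have cc : c `^ (- (3 * alpha)) = 1 + eta / 2.
  by rewrite /c -powRrM mulrNN mulVf ?gt_eqF// powRr1// ltW.
have c2 : 0 < c ^+ 2 by rewrite exprn_gt0.
have c2c : c ^+ 2 < c by rewrite expr2 gtr_pMl.
have ci : 1 < c^-1 by rewrite invf_gt1.
pose G r := fine (mu (norm_gt r)).
have G1 : 0 < G 1 := mu_norm_gt1 mu0 mu_neq0 mu_homo.
have fin a a' : 0 < a -> a < a' -> mu_ramp mu a a' \is a fin_num.
  move=> a0 aa; have /andP[h1 h2] := mu_ramp_bounds mu0 a0 aa.
  rewrite fin_numElt; apply/andP; split.
    by apply: lt_le_trans h1; exact: ltNyr.
  by apply: le_lt_trans h2 _; exact: ltry.
pose i1 := fine (mu_ramp mu (c ^+ 2) c); pose i2 := fine (mu_ramp mu 1 c^-1).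
have i1le : i1 <= c `^ (- (2 * alpha)) * G 1.
  have /andP[_] := mu_ramp_bounds mu0 c2 c2c.
  rewrite -[X in (X <= _)%E]fineK ?fin// lee_fin => /le_trans; apply.
  have -> : c `^ (- (2 * alpha)) = (c ^+ 2) `^ (- alpha).
    by rewrite -(powR_mulrn _ (ltW c0)) -powRrM mulrN.
  by rewrite (mu_norm_gt_homo mu0 mu_homo c2).
have i2ge : c `^ alpha * G 1 <= i2.
  have /andP[+ _] := mu_ramp_bounds mu0 ltr01 ci.
  rewrite -[X in (_ <= X)%E]fineK ?fin// lee_fin; apply: le_trans.
  have -> : c `^ alpha = c^-1 `^ (- alpha).
    by rewrite -(powR_inv1 (ltW c0)) -powRrM mulrNN mul1r.
  by rewrite (mu_norm_gt_homo mu0 mu_homo) ?invr_gt0.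
have ii : i1 < (1 + eta) * i2.
  apply: le_lt_trans i1le _; apply: lt_le_trans (ler_wpM2l _ i2ge); last lra.
  rewrite mulrA ltr_pM2r//.
  have -> : c `^ (- (2 * alpha)) = c `^ (- (3 * alpha)) * c `^ alpha.
    rewrite -powRD; last by apply/implyP => _; rewrite gt_eqF.
    by congr (_ `^ _); ring.
  by rewrite cc ltr_pM2r ?powR_gt0//; lra.
have i20 : 0 < i2 by apply: lt_le_trans i2ge; rewrite mulr_gt0 ?powR_gt0.
pose u1 n := fine (\int[scaled_law X b n]_(x in punctured) (ramp (c ^+ 2) c
    x)%:E)%E.
pose u2 n := fine (\int[scaled_law X b n]_(x in punctured) (ramp 1 c^-1
    x)%:E)%E.
have cu1 : u1 n @[n --> \oo] --> i1.
  by apply: fine_cvg; rewrite fineK ?fin//; exact/cvgmu/C0_ramp.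
have cu2 : u2 n @[n --> \oo] --> i2.
  by apply: fine_cvg; rewrite fineK ?fin//; exact/cvgmu/C0_ramp.
have main : \forall n \near \oo, tail_prob X (n%:R * c) <= (1 + eta) *
    tail_prob X n%:R.
  have cd : (1 + eta) * u2 n - u1 n @[n --> \oo] --> (1 + eta) * i2 - i1.
    by apply: cvgB => //; apply: cvgM => //; exact: cvg_cst.
  near=> n; have n0 : (0 < n)%N by near: n; exists 1%N.
  have d0 : 0 < (1 + eta) * u2 n - u1 n.
    by near: n; apply: (cvgr_gt _ cd); rewrite subr_gt0.
  have u20 : 0 < u2 n by near: n; exact: (cvgr_gt _ cu2).
  (* A nonpositive [b n] would give a nonpositive integral, against [0 < u2 n]. *)
  have bn : 0 < b n%:R.
    rewrite ltNge; apply: contraTN u20 => bn; rewrite -leNgt.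
    by apply: fine_le0; apply: integral_scaled_law_ramp_le0.
  move: d0; rewrite /u1 /u2 (integral_scaled_law_ramp X n0 c2 c2c (ltW bn))
    (integral_scaled_law_ramp X n0 ltr01 ci (ltW bn)) /=.
  rewrite subr_gt0 mulrCA ltr_pM2l// => /ltW h.
  apply: (le_trans (tail_prob_le_ramp X n0 c2c)); apply: (le_trans h).
  rewrite ler_wpM2l//; first by lra.
  by have := ramp_le_tail_prob X n0 ci; rewrite mulr1.
have [N _ hN] := main.
(* From [n >= c / (1 - c)] follows [(n + 1) * c <= n]: the contraction by [c] at [n + 1] spans at
   least a unit step. *)
pose M := (Num.truncn (c / (1 - c))).+1.
exists (maxn N M) => // n /=; rewrite geq_max => /andP[Nn Mn].
apply: le_trans (hN n.+1 (leqW Nn)); apply: tail_prob_nonincreasing.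
have cM : c / (1 - c) <= n%:R.
  apply: (@le_trans _ _ M%:R); first by apply/ltW; exact: truncnS_gt.
  by rewrite ler_nat.
move: cM; rewrite ler_pdivrMr ?subr_gt0// -natr1; lra.
Unshelve. all: by end_near. Qed.

Hypothesis V0 : forall t, 0 < tail_prob X t.

(** [m n] is the least integer whose tail is at most [k n / n]. The tail at its predecessor exceeds
    this quotient, and the ratio of consecutive tails tends to 1. *)
Lemma exists_thresholds (alpha : R) (k : nat -> nat) : regularly_varying P X
    alpha ->
  (forall n, (0 < n)%N -> (1 <= k n <= n)%N) ->
  (k n)%:R / n%:R @[n --> \oo] --> (0 : R) ->
  exists m : nat -> nat, (m n)%:R @[n --> \oo] --> (+oo : set_system R) /\
    n%:R * tail_prob X (m n)%:R / (k n)%:R @[n --> \oo] --> (1 : R).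
Proof.
move=> rv kn k0.
(* At [n = 0] the quotient is 0 by convention and no level reaches it, hence the guard. *)
have ex n : exists m, (0 < n)%N -> tail_prob X m%:R <= (k n)%:R / n%:R /\
    forall j, (j < m)%N -> (k n)%:R / n%:R < tail_prob X j%:R.
  have [->|n0] := posnP n; first by exists 0%N.
  have /andP[kn1 _] := kn _ n0.
  have kp : 0 < (k n)%:R / n%:R :> R by rewrite divr_gt0 ?ltr0n.
  have exm : exists m : nat, tail_prob X m%:R <= (k n)%:R / n%:R.
    near \oo => m; exists m; apply: ltW; near: m.
    exact: (cvgr_lt _ (tail_prob_cvg0 X)).
  have [m Vm mmin] := ex_minnP exm; exists m => _; split=> // j jm.
  by rewrite ltNge; apply: contraL jm => /mmin; rewrite leqNgt.
have [m mP] := choice ex; exists m.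
(* Eventually [k n / n] is below the positive tail at [K], so no level up to [K] qualifies. *)
have mlarge (K : nat) : \forall n \near \oo, (K < m n)%N.
  near=> n; have n0 : (0 < n)%N by near: n; exists 1%N.
  rewrite ltnNge; apply/negP => mK.
  have : (k n)%:R / n%:R < tail_prob X K%:R by near: n; exact: (cvgr_lt _ k0).
  apply/negP; rewrite -leNgt; apply: le_trans (mP n n0).1.
  by apply: tail_prob_nonincreasing; rewrite ler_nat.
split.
  apply/cvgryPge => A; near=> n; apply: (@le_trans _ _ (Num.truncn A).+1%:R).
    by apply/ltW; exact: truncnS_gt.
  by rewrite ler_nat; near: n; have := mlarge (Num.truncn A); exact.
apply/cvgrPdist_le => e e0.
have [N _ hN] := tail_prob_ratio rv e0.
near=> n; have n0 : (0 < n)%N by near: n; exists 1%N.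
have kp : 0 < (k n)%:R :> R by rewrite ltr0n; case/andP: (kn _ n0).
have np : 0 < n%:R :> R by rewrite ltr0n.
have Nm : (N < m n)%N by near: n; exact: mlarge.
have [h1 h2] := mP _ n0.
(* Being larger than [N], [m n] is a successor, and its predecessor is in the range of both
   minimality and the ratio bound. *)
case Em : (m n) Nm h1 h2 => [//|j] Nj h1 h2.
have {}h2 := h2 j (ltnSn j).
have h3 := hN j Nj.
set V := tail_prob X j.+1%:R in h1 h3 *.
have u1 : n%:R * V / (k n)%:R <= 1.
  by rewrite ler_pdivrMr// mul1r mulrC -ler_pdivlMr.
have u2 : 1 <= (1 + e) * (n%:R * V / (k n)%:R).
  rewrite mulrA ler_pdivlMr// mul1r mulrCA mulrC -ler_pdivrMr//.
  by apply: ltW; exact: lt_le_trans h2 h3.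
rewrite ger0_norm ?subr_ge0//; move: u1 u2; set u := _ / _; nra.
Unshelve. all: by end_near. Qed.

End thresholds.

(** * Law of large numbers for the extreme angles *)

Section top_avg_convergence.
Context {R : realType} {H : hilbertType R} {d : measure_display}
  {T : measurableType d}.
Variables (P : probability T R) (X : {RV P >-> borel H}) (Q : probability
    (borel H) R)
  (X_ : nat -> {RV P >-> borel H}) (sigma : forall n, T -> 'S_n) (alpha : R)
  (k : nat -> nat).
Hypothesis X_iid : forall i (A : set (borel H)), measurable A ->
  distribution P (X_ i) A = distribution P X A.
Hypothesis X_indep : mutually_independent P (fun i => X_ i).
Hypothesis X_ord : norm_ordering (fun i => X_ i) sigma.
Hypothesis X_rv : regularly_varying P X alpha.
Hypothesis X_Q : limit_angular_measure P X Q.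
Hypothesis k_bounds : forall n, (0 < n)%N -> (1 <= k n <= n)%N.
Hypothesis k_cvg : k n @[n --> \oo] --> \oo.
Hypothesis k_ratio : (k n)%:R / n%:R @[n --> \oo] --> (0 : R).

(** The nonnegative case is applied to [psi + M]; since the tail is positive, the shift adds exactly
    [M] to each ratio, as it does to the limit. *)
Lemma tail_mean_cvg_signed (psi : borel H -> R) : continuous (psi : H -> R) ->
  bounded_mfun psi ->
  tail_mean X t psi / tail_prob X t @[t --> +oo] --> mean Q psi.
Proof.
move=> cpsi bpsi; have [_ [M psiM]] := bpsi.
pose psi1 x := psi x + M.
have bM := bounded_mfun_cst (T := borel H) M.
have b1 : bounded_mfun psi1 by exact: bounded_mfunD.
have c1 : continuous (psi1 : H -> R).
  by move=> x; apply: cvgD; [exact: cpsi|exact: cvg_cst].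
have p1 x : 0 <= psi1 x.
  by have := psiM x; rewrite ler_norml /psi1 => /andP[h _]; rewrite -lerBlDr
      sub0r.
have V0 := tail_prob_gt0 X_Q.
have := tail_mean_cvg X_Q c1 b1 p1.
rewrite meanD// mean_cst => h.
have -> : mean Q psi = mean Q psi + M - M by rewrite addrK.
have -> : (fun t => tail_mean X t psi / tail_prob X t) =
    (fun t => tail_mean X t psi1 / tail_prob X t - M).
  apply/funext => t; have Vt := V0 t.
  suff -> : tail_mean X t psi1 = tail_mean X t psi + M * tail_prob X t.
    by field; rewrite gt_eqF.
  rewrite tail_probE -meanZ; last exact: bounded_mfun_above.
  rewrite -meanD; [|exact:
      bounded_mfun_tail|exact/bounded_mfunZ/bounded_mfun_above].
  by apply: eq_mean => w; rewrite /psi1 mulrDl.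
by apply: cvgB => //; exact: cvg_cst.
Qed.

Lemma top_avg_cvg (psi : borel H -> R) (delta : R) : continuous (psi : H -> R)
    ->
  bounded_mfun psi -> 0 < delta ->
  P [set w | (delta < `|top_avg X_ sigma n (k n) psi w - mean Q psi|)%R]
    @[n --> \oo] --> 0%E.
Proof.
move=> cpsi bpsi delta0; have [_ [M psiM]] := bpsi.
have V0 := tail_prob_gt0 X_Q.
have [m [m_oo v1]] := exists_thresholds V0 X_rv k_bounds k_ratio.
set L := mean Q psi.
pose v n := n%:R * tail_prob X (m n)%:R / (k n)%:R.
pose u n := n%:R * tail_mean X (m n)%:R psi / (k n)%:R.
have cu : u n @[n --> \oo] --> L.
  (* The normalized cut-off mean is the normalized expected count times the conditional mean above
     the level; the two factors converge separately. *)
  have -> : u = (fun n => v n * (tail_mean X (m n)%:R psi / tail_prob X (m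
      n)%:R)).
    apply/funext => n; rewrite /u /v.
    have Vn : tail_prob X (m n)%:R != 0 by rewrite gt_eqF.
    rewrite -[in LHS](divfK Vn (tail_mean X (m n)%:R psi)).
    set r := tail_mean _ _ _ / _; set kn := (k n)%:R^-1; ring.
  rewrite -[L]mul1r; apply: cvgM => //.
  exact: cvg_comp m_oo (tail_mean_cvg_signed cpsi bpsi).
have cb : M * `|v n - 1| + `|u n - L| @[n --> \oo] --> (0 : R).
  have -> : 0 = M * `|1 - 1| + `|L - L| :> R by rewrite !subrr normr0 mulr0
      addr0.
  apply: cvgD; last by apply: cvg_norm; apply: cvgB => //; exact: cvg_cst.
  apply: cvgM; first exact: cvg_cst.
  by apply: cvg_norm; apply: cvgB => //; exact: cvg_cst.
have ck : (k n)%:R^-1 @[n --> \oo] --> (0 : R).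
  apply/gtr0_cvgV0; last first.
    by apply: cvg_comp k_cvg _; exact: cvgr_idn.
  near=> n; rewrite ltr0n; suff /andP[] : (1 <= k n <= n)%N by [].
  by apply: k_bounds; near: n; exists 1%N.
have cB : (18 * M ^+ 2 * v n / (k n)%:R / delta ^+ 2)%:E @[n --> \oo] --> 0%:E.
  apply: cvg_EFin; first by apply: nearW.
  have -> : 0 = 18 * M ^+ 2 * 1 * 0 / delta ^+ 2 :> R by rewrite mulr0 mul0r.
  apply: cvgM; last exact: cvg_cst.
  apply: cvgM => //; apply: cvgM => //; exact: cvg_cst.
apply: (@squeeze_cvge _ _ _ _ (cst 0%E) _
  (fun n => (18 * M ^+ 2 * v n / (k n)%:R / delta ^+ 2)%:E)) => //; last exact:
      cvg_cst.
near=> n; rewrite measure_ge0 /=.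
apply: (top_avg_concentration X_iid X_indep X_ord (M := M)) => //.
  by apply: k_bounds; near: n; exists 1%N.
near: n; apply: (cvgr_le _ cb); by rewrite divr_gt0.
Unshelve. all: by end_near. Qed.

End top_avg_convergence.

(** * Coordinates on the unit ball *)

Section coordinates.
Context {R : realType} {H : hilbertType R}.
Implicit Types (x e f : H) (s : seq H).

(* Precomposing with this retraction makes functions that are bounded on the
   unit ball globally bounded. *)
Definition unit_retract (x : H) : H := (Num.max 1 `|x|)^-1 *: x.

Lemma unit_retract_id x : `|x| <= 1 -> unit_retract x = x.
Proof. by move=> x1; rewrite /unit_retract max_l// invr1 scale1r. Qed.

Lemma norm_unit_retract x : `|unit_retract x| <= 1.
Proof.
have m0 : 0 < Num.max 1 `|x| by rewrite lt_max ltr01.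
rewrite normrZ ger0_norm ?invr_ge0 ?(ltW m0)// mulrC ler_pdivrMr// mul1r.
by rewrite le_max lexx orbT.
Qed.

Lemma continuous_unit_retract : continuous unit_retract.
Proof.
move=> x; apply: cvgZ; last exact: cvg_id.
apply: cvgV; first by rewrite gt_eqF// lt_max ltr01.
apply: (@continuous_max _ _ (cst 1) (fun x : H => `|x|)).
  exact: cst_continuous.
exact: norm_continuous.
Qed.

(** On the unit ball, where all angles lie, this is the matrix entry [hdot f (tensor x x e)]. *)
Definition unit_coord e f (x : borel H) : R :=
  hdot e (unit_retract x) * hdot f (unit_retract x).

Lemma continuous_coord1 e : continuous (fun x : H => hdot e (unit_retract x)).
Proof.
move=> x; apply: (@continuous_comp _ _ _ unit_retract (hdot e)).
  exact: continuous_unit_retract.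
exact: continuous_hdotr.
Qed.

Lemma continuous_coord e f : continuous (unit_coord e f : H -> R).
Proof. by move=> x; apply: cvgM; exact: continuous_coord1. Qed.

Lemma norm_coord1_le e x : `|hdot e (unit_retract x)| <= `|e|.
Proof.
rewrite (le_trans (hdot_CauchySchwarz _ _))// ler_piMr//.
exact: norm_unit_retract.
Qed.

Lemma bounded_mfun_coord1 e :
  bounded_mfun (fun x : borel H => hdot e (unit_retract (x : H))).
Proof.
split; last by exists `|e| => x; exact: norm_coord1_le.
by apply: continuous_borel_measurable; exact: continuous_coord1.
Qed.

Lemma bounded_mfun_coord e f : bounded_mfun (unit_coord e f).
Proof. by apply: bounded_mfunM; exact: bounded_mfun_coord1. Qed.

Definition energy s (x : borel H) : R := \sum_(e <- s) hdot e (unit_retract x)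
    ^+ 2.

Lemma sum_sqr_coord s x :
  \sum_(e <- s) \sum_(f <- s) unit_coord e f x ^+ 2 = energy s x ^+ 2.
Proof.
rewrite expr2 mulr_suml; apply: eq_bigr => e _; rewrite mulr_sumr.
by apply: eq_bigr => f _; rewrite exprMn.
Qed.

Lemma energy_ge0 s x : 0 <= energy s x.
Proof. by apply: sumr_ge0 => e _; rewrite sqr_ge0. Qed.

Lemma continuous_energy s : continuous (energy s : H -> R).
Proof.
move=> x; apply: cvg_big => [|e _]; first exact: add_continuous.
by under eq_fun do rewrite expr2; apply: cvgM; exact: continuous_coord1.
Qed.

Lemma bounded_mfun_energy s : bounded_mfun (energy s).
Proof. by apply: bounded_mfun_sum => e; apply: bounded_mfunX; exact:
    bounded_mfun_coord1. Qed.

(** For [x] on the unit sphere and [s] orthonormal, the squared Hilbert-Schmidt mass of [tensor x x]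
    outside the block indexed by [s]. *)
Definition energy_defect s (x : borel H) : R := 1 - energy s x ^+ 2.

Lemma bounded_mfun_energy_defect s : bounded_mfun (energy_defect s).
Proof.
by apply: bounded_mfunB; [exact: bounded_mfun_cst|apply: bounded_mfunX; exact:
    bounded_mfun_energy].
Qed.

Lemma continuous_energy_defect s : continuous (energy_defect s : H -> R).
Proof.
move=> x; apply: cvgB; first exact: cvg_cst.
by rewrite /= expr2; under eq_fun do rewrite expr2; apply: cvgM; exact:
    continuous_energy.
Qed.

End coordinates.

(** * Comparison of positive functionals on coordinates *)

Section positive_functionals.
Context {d : measure_display} {T : measurableType d} {R : realType}.

(** Covers the integral against [Q] and, for a fixed outcome, the average over the extremes, without
    building an empirical measure. *)
Record positive_functional (L : (T -> R) -> R) : Prop := PositiveFunctional {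
  pf_add : forall f g, bounded_mfun f -> bounded_mfun g ->
    L (fun x => f x + g x) = L f + L g ;
  pf_scale : forall c f, bounded_mfun f -> L (fun x => c * f x) = c * L f ;
  pf_le : forall f g, bounded_mfun f -> bounded_mfun g ->
    (forall x, f x <= g x) -> L f <= L g ;
  pf_cst : forall c, L (cst c) = c }.

Lemma positive_functional_mean (Q : probability T R) : positive_functional
    (mean Q).
Proof.
split; [exact: meanD|exact: meanZ|exact: le_mean|exact: mean_cst].
Qed.

Variable L : (T -> R) -> R.
Hypothesis pL : positive_functional L.

Lemma pf_sum I (s : seq I) (F : I -> T -> R) : (forall i, bounded_mfun (F i)) ->
  L (fun x => \sum_(i <- s) F i x) = \sum_(i <- s) L (F i).
Proof.
move=> bF; elim: s => [|i s IH].
  by under eq_fun do rewrite big_nil; rewrite big_nil; exact: (pf_cst pL).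
under eq_fun do rewrite big_cons; rewrite big_cons -IH (pf_add pL)//.
exact: bounded_mfun_sum.
Qed.

(** Jensen from the tangent line of the square at [m = L f]: [2 * m * f - m ^+ 2 <= f ^+ 2]. *)
Lemma pf_sqr_le f : bounded_mfun f -> L f ^+ 2 <= L (fun x => f x ^+ 2).
Proof.
move=> bf; set m := L f; have b2 := bounded_mfunX 2 bf.
have bm := bounded_mfun_cst (T := T) (- (m ^+ 2)).
have bf2 := bounded_mfunZ (2 * m) bf.
have : L (fun x => 2 * m * f x + - (m ^+ 2)) <= L (fun x => f x ^+ 2).
  apply: (pf_le pL) => //; first exact: bounded_mfunD.
  by move=> x; have := sqr_ge0 (f x - m); lra.
rewrite (pf_add pL)// (pf_scale pL)// (pf_cst pL) -/m; lra.
Qed.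

End positive_functionals.

Section top_avg_functional.
Context {R : realType} {H : hilbertType R} {d : measure_display}
  {T : measurableType d}.
Variables (P : probability T R) (X_ : nat -> {RV P >-> borel H})
  (sigma : forall n, T -> 'S_n).

Lemma positive_functional_top_avg n k w : (1 <= k <= n)%N ->
  positive_functional (fun psi => top_avg X_ sigma n k psi w).
Proof.
move=> /andP[k1 kn]; have k0 : 0 < k%:R :> R by rewrite ltr0n.
split=> [f g _ _|c f _|f g _ _ fg|c].
- by rewrite /top_avg big_split/= mulrDr.
- by rewrite /top_avg -mulr_sumr mulrCA.
- by rewrite /top_avg ler_wpM2l ?invr_ge0 ?ler0n// ler_sum.
- rewrite /top_avg sumr_const -[X in _ * X]mulr_natl.
  suff -> : #|[pred i : 'I_n | (i < k)%N]| = k by rewrite mulKf ?gt_eqF.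
  by rewrite -sum1_card (big_ord_narrow kn) sum1_card card_ord.
Qed.

End top_avg_functional.

Section coordinate_distance.
Context {R : realType} {H : hilbertType R}.
Variables (B : set H) (F : nat -> seq H).
Hypothesis oB : orthonormal_basis B.
Hypothesis uF : forall n, uniq (F n).
Hypothesis FB : forall n e, e \in F n -> B e.
Hypothesis F_homo : forall m n, (m <= n)%N -> {subset F m <= F n}.

Lemma ler_dsum_subset (s t : seq H) (G : H -> H -> R) : uniq s -> uniq t ->
  {subset s <= t} -> (forall e f, 0 <= G e f) ->
  \sum_(e <- s) \sum_(f <- s) G e f <= \sum_(e <- t) \sum_(f <- t) G e f.
Proof.
move=> us ut st G0; apply: (@le_trans _ _ (\sum_(e <- s) \sum_(f <- t) G e f)).
  by apply: ler_sum => e _; exact: ler_sum_subset_uniq.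
by apply: ler_sum_subset_uniq => // e; exact: sumr_ge0.
Qed.

Lemma energy_le1 n x : energy (F n) x <= 1.
Proof.
apply: le_trans (bessel oB (unit_retract x) (uF n) (@FB n)) _.
by rewrite expr_le1// norm_unit_retract.
Qed.

Lemma coord_functional_distance (L L' : (borel H -> R) -> R) N n :
  positive_functional L -> positive_functional L' ->
  \sum_(e <- F n) \sum_(f <- F n) (L (unit_coord e f) - L' (unit_coord e f)) ^+
      2 <=
  \sum_(e <- F N) \sum_(f <- F N) (L (unit_coord e f) - L' (unit_coord e f)) ^+
      2 +
  2 * (L (energy_defect (F N)) + L' (energy_defect (F N))).
Proof.
move=> pL pL'.
pose D (A : (borel H -> R) -> R) : R := A (energy_defect (F N)).
have D0 A : positive_functional A -> 0 <= D A.
  move=> pA; rewrite -[leLHS](pf_cst pA); apply: (pf_le pA).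
  - exact: bounded_mfun_cst.
  - exact: bounded_mfun_energy_defect.
  by move=> x; rewrite subr_ge0 expr_le1 ?energy_le1 ?energy_ge0.
have bsq e f := bounded_mfunX 2 (@bounded_mfun_coord R H e f).
have [nN|Nn] := leP n N.
  rewrite -[leLHS]addr0 lerD//; last by rewrite mulr_ge0 ?addr_ge0 ?D0.
  by apply: ler_dsum_subset => //; [exact: F_homo|move=> e f; rewrite sqr_ge0].
pose S (G : H -> H -> R) k : R := \sum_(e <- F k) \sum_(f <- F k) G e f.
(* The part of a double sum outside the block [F N] is monotone in its nonnegative summand. *)
have out G G' : (forall e f, 0 <= G e f <= G' e f) -> S G n - S G N <= S G' n -
    S G' N.
  move=> GG.
  have : S (fun e f => G' e f - G e f) N <= S (fun e f => G' e f - G e f) n.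
    apply: ler_dsum_subset => //; first exact/F_homo/ltnW.
    by move=> e f; rewrite subr_ge0; case/andP: (GG e f).
  have SB k : S (fun e f => G' e f - G e f) k = S G' k - S G k.
    by rewrite /S -sumrB; apply: eq_bigr => e _; rewrite sumrB.
  rewrite !SB; lra.
pose G (A : (borel H -> R) -> R) e f : R := A (fun x => unit_coord e f x ^+ 2).
have SG A k : positive_functional A -> S (G A) k = A (fun x => energy (F k) x
    ^+ 2).
  move=> pA; rewrite /S /G.
  have -> : (fun x => energy (F k) x ^+ 2) =
      (fun x => \sum_(e <- F k) \sum_(f <- F k) unit_coord e f x ^+ 2).
    by apply/funext => x; rewrite sum_sqr_coord.
  rewrite (pf_sum pA); last by move=> e; apply: bounded_mfun_sum.
  by apply: eq_bigr => e _; rewrite (pf_sum pA).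
have be k : bounded_mfun (fun x => energy (F k) x ^+ 2).
  by apply: bounded_mfunX; exact: bounded_mfun_energy.
(* The outer squared entries add up to a difference of squared energies, of which the larger is at
   most 1. *)
have SD A : positive_functional A -> S (G A) n - S (G A) N <= D A.
  move=> pA; rewrite !SG// lerBlDr /D -(pf_add pA)//; last exact:
      bounded_mfun_energy_defect.
  apply: (pf_le pA) => //.
    by apply: bounded_mfunD => //; exact: bounded_mfun_energy_defect.
  by move=> x; rewrite /energy_defect subrK expr_le1 ?energy_le1 ?energy_ge0.
pose Gd e f := (L (unit_coord e f) - L' (unit_coord e f)) ^+ 2.
(* Majorant from [(a - b)^2 <= 2 a^2 + 2 b^2] followed by Jensen for each functional. *)
have h := out Gd (fun e f => 2 * G L e f + 2 * G L' e f).
have {h} := h _; rewrite /= => h.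
have {}h : S Gd n - S Gd N <= 2 * (S (G L) n - S (G L) N) + 2 * (S (G L') n - S
    (G L') N).
  have SDb k : S (fun e f => 2 * G L e f + 2 * G L' e f) k = 2 * S (G L) k + 2
      * S (G L') k.
    rewrite /S !mulr_sumr -big_split /=; apply: eq_bigr => e _.
    by rewrite !mulr_sumr -big_split.
  rewrite !SDb in h; apply: le_trans (h _) _; last by lra.
  move=> e f; rewrite sqr_ge0 /=.
  have := pf_sqr_le pL (@bounded_mfun_coord R H e f).
  have := pf_sqr_le pL' (@bounded_mfun_coord R H e f).
  rewrite /Gd /G; have := sqr_ge0 (L (unit_coord e f) + L' (unit_coord e f));
      lra.
have h1 := SD L pL; have h2 := SD L' pL'.
rewrite -/(S Gd n) -/(S Gd N) -/(D L) -/(D L'); lra.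
Qed.

End coordinate_distance.

(** * Approximation by simple operators *)

Section mean_convergence.
Context {d : measure_display} {T : measurableType d} {R : realType}.
Variable P : probability T R.

Lemma bounded_mean_cvg (f : nat -> T -> R) (g : T -> R) (M : R) :
  (forall n, bounded_mfun (f n)) -> bounded_mfun g ->
  (forall n w, `|f n w| <= M) -> (forall w, f n w @[n --> \oo] --> g w) ->
  mean P (f n) @[n --> \oo] --> mean P g.
Proof.
move=> bf bg fM fg; apply: fine_cvg; rewrite fineK; last first.
  exact/integrable_fin_num/bounded_mfun_integrable.
have := @dominated_convergence _ _ _ P setT measurableT
  (fun n w => (f n w)%:E) (EFin \o g) (cst M%:E).
case => //.
- by move=> n; apply/measurable_EFinP; case: (bf n).
- by apply/measurable_EFinP; case: bg.
- by apply: aeW => w _; apply: cvg_EFin; [exact: nearW|exact: fg].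
- exact: (bounded_mfun_integrable P (bounded_mfun_cst M)).
- by apply: aeW => w n _; rewrite /= lee_fin.
Qed.

(* No measurability is required, which spares proving it for Hilbert-Schmidt
   norms of operator-valued maps. *)
Lemma ge0_le_integral_raw (f g : T -> \bar R) :
  (forall w, (0 <= f w)%E) -> (forall w, (f w <= g w)%E) ->
  (\int[P]_w f w <= \int[P]_w g w)%E.
Proof.
move=> f0 fg; rewrite !ge0_integralE//; last by move=> w _; exact: le_trans (fg
    w).
apply: le_ereal_sup => _ [h hf <-]; exists h => // w.
apply: le_trans (hf w) _; rewrite !patchE; case: ifP => // _; exact: fg.
Qed.

Lemma mean_negligible (f g : T -> R) (A : set T) : measurable A -> P A = 1%E ->
  (forall w, A w -> f w = g w) -> bounded_mfun f -> bounded_mfun g ->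
  mean P f = mean P g.
Proof.
move=> mA PA fg bf bg; rewrite /mean /Rintegral; congr fine.
have PCA : P (~` A) = 0%E by rewrite probability_setC// PA subee.
rewrite (negligible_integral (measurableC mA) measurableT
    (bounded_mfun_integrable P bf))//.
rewrite (negligible_integral (measurableC mA) measurableT
    (bounded_mfun_integrable P bg))//.
rewrite setTD setCK; by apply: eq_integral => w /set_mem Aw /=; rewrite fg.
Qed.

End mean_convergence.

(** * Discretization by nearest points *)

Section nearest_point.
Context {R : realType} {H : hilbertType R}.

Lemma separable_dense_seq : separable H ->
  exists D : nat -> H, forall x (e : R), 0 < e -> exists n, `|D n - x| < e.
Proof.
move=> [D cD dD]; have /countable_injP[i iinj] := cD.
(* Indices that are not attained give a default point, which does not affect density. *)
exists (fun n => get [set x | D x /\ i x = n]) => x e e0.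
have [y [yx Dy]] : (ball x e `&` D) !=set0.
  by apply: dD; [exists x; exact: ballxx|exact: ball_open].
exists (i y); set z := get _.
have [Dz iz] : D z /\ i z = i y by apply: (getPex (P := [set x | D x /\ i x = i
    y])); exists y.
have -> : z = y by apply: iinj => //; exact/mem_set.
by move: yx; rewrite -ball_normE /= distrC.
Qed.

Variable D : nat -> H.

(** The candidates are 0 and the first [n] points of [D]. Starting from 0 keeps the distance below
    the norm of [x], which yields the domination needed in the limit. *)
Fixpoint nearest_dist (n : nat) (x : H) : R :=
  if n is n'.+1 then Num.min (nearest_dist n' x) `|D n' - x| else `|x|.

Fixpoint nearest (n : nat) (x : H) : H :=
  if n is n'.+1 then if nearest_dist n' x <= `|D n' - x| then nearest n' x else
      D n'
  else 0.

Lemma norm_nearest_sub n x : `|nearest n x - x| = nearest_dist n x.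
Proof.
elim: n => [|n IH] /=; first by rewrite sub0r normrN.
by case: (leP (nearest_dist n x)) => h; rewrite ?IH ?min_l// ?min_r// ltW.
Qed.

Lemma nearest_dist_ge0 n x : 0 <= nearest_dist n x.
Proof. by rewrite -norm_nearest_sub. Qed.

Lemma nearest_dist_le n x : nearest_dist n x <= `|x|.
Proof. by elim: n => //= n IH; rewrite ge_min IH. Qed.

Lemma nearest_dist_homo x : {homo nearest_dist^~ x : m n / (m <= n)%N >-> n <=
    m}.
Proof.
apply: homo_leq => [//|y z t yz zt|n]; first exact: le_trans zt yz.
by rewrite /= ge_min lexx.
Qed.

Lemma norm_nearest_le n x : `|nearest n x| <= 2 * `|x|.
Proof.
rewrite -[nearest n x](subrK x) (le_trans (ler_normD _ _))// norm_nearest_sub.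
have := nearest_dist_le n x; lra.
Qed.

Lemma continuous_nearest_dist n : continuous (nearest_dist n).
Proof.
elim: n => [|n IH] x /=; first exact: norm_continuous.
apply: (@continuous_min _ _ (nearest_dist n) (fun x => `|D n - x|)).
  exact: IH.
by apply: cvg_norm; apply: cvgB; [exact: cvg_cst|exact: cvg_id].
Qed.

Lemma measurable_nearest n : measurable_fun setT (nearest n : borel H -> borel
    H).
Proof.
elim: n => [|n IH] /=; first exact: measurable_cst.
apply: measurable_fun_ifT => //.
apply: measurable_fun_ler; apply: continuous_borel_measurable.
  exact: continuous_nearest_dist.
by move=> x; apply: cvg_norm; apply: cvgB; [exact: cvg_cst|exact: cvg_id].
Qed.

Lemma finite_range_nearest n : finite_set (range (nearest n)).
Proof.
apply: (@sub_finite_set _ _ ([set 0] `|` D @` `I_n)).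
  move=> _ [x _ <-]; elim: n => [|n IH]; first by left.
  have sub : D @` `I_n `<=` D @` `I_n.+1.
    by move=> _ [i ni <-]; exists i => //; exact: ltnW.
  rewrite [nearest _ _]/=; case: ifP => _; last by right; exists n => /=.
  by case: IH => [|/sub]; [left|right].
by rewrite finite_setU; split; [exact: finite_set1|exact: finite_image].
Qed.

Hypothesis D_dense : forall x (e : R), 0 < e -> exists n, `|D n - x| < e.

Lemma nearest_dist_cvg x : nearest_dist n x @[n --> \oo] --> (0 : R).
Proof.
apply/cvgrPdist_lt => e e0; have [m Dm] := D_dense x e0.
exists m.+1 => // n /= mn; rewrite sub0r normrN ger0_norm ?nearest_dist_ge0//.
apply: le_lt_trans Dm; apply: (le_trans (nearest_dist_homo x mn)).
by rewrite /= ge_min lexx orbT.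
Qed.

End nearest_point.

(** * Hilbert-Schmidt distance of tensor squares *)

Section tensor_norm.
Context {R : realType} {H : hilbertType R}.
Variables (B : set H) (F : nat -> seq H).
Hypothesis oB : orthonormal_basis B.
Hypothesis uF : forall n, uniq (F n).
Hypothesis FB : forall n e, e \in F n -> B e.
Hypothesis F_homo : forall m n, (m <= n)%N -> {subset F m <= F n}.
Hypothesis F_exhausts : forall e, B e -> exists n, e \in F n.

Let besselF n x : \sum_(e <- F n) hdot e x ^+ 2 <= `|x| ^+ 2.
Proof. by apply: (bessel oB) => // e; exact: FB. Qed.

Lemma hdot_tensor (y : H) e f : hdot f (tensor y y e) = hdot e y * hdot f y.
Proof. by rewrite /tensor hdotZr (hdotC y). Qed.

(** The tensor square is locally Lipschitz: each entry splits as
    [a e * (a f - b f) + (a e - b e) * b f], and Bessel is applied in each index. *)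
Lemma sum_sqr_tensorB (y z : H) n :
  \sum_(e <- F n) \sum_(f <- F n)
    (hdot e y * hdot f y - hdot e z * hdot f z) ^+ 2 <=
  2 * (`|y| ^+ 2 + `|z| ^+ 2) * `|y - z| ^+ 2.
Proof.
pose a e : R := hdot e y; pose b e : R := hdot e z.
pose A := \sum_(e <- F n) a e ^+ 2; pose Z := \sum_(e <- F n) b e ^+ 2.
pose D := \sum_(e <- F n) hdot e (y - z) ^+ 2.
have A0 : 0 <= A by apply: sumr_ge0 => e _; rewrite sqr_ge0.
have Z0 : 0 <= Z by apply: sumr_ge0 => e _; rewrite sqr_ge0.
have D0 : 0 <= D by apply: sumr_ge0 => e _; rewrite sqr_ge0.
apply: (@le_trans _ _ (2 * (A * D) + 2 * (D * Z))); last first.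
  have := besselF n y; have := besselF n z; have := besselF n (y - z).
  rewrite -/A -/Z -/D => hD hZ hA.
  have h1 : A * D <= `|y| ^+ 2 * `|y - z| ^+ 2 by apply: ler_pM.
  have h2 : D * Z <= `|y - z| ^+ 2 * `|z| ^+ 2 by apply: ler_pM.
  lra.
rewrite /A /D /Z !mulr_suml !mulr_sumr -big_split /=; apply: ler_sum => e _.
rewrite !mulr_sumr -big_split /=; apply: ler_sum => f _.
have -> : a e * a f - b e * b f = a e * (a f - b f) + (a e - b e) * b f by ring.
rewrite !hdotBr -!exprMn; apply: le_trans (_ : _ <= 2 * (a e * (a f - b f)) ^+
    2 + 2 * ((a e - b e) * b f) ^+ 2) _ => //.
set u := a e * _; set v := _ * b f; have := sqr_ge0 (u - v); lra.
Qed.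

Lemma HS_norm_tensorB (y z : H) (M : R) : 0 <= M ->
  2 * (`|y| ^+ 2 + `|z| ^+ 2) * `|y - z| ^+ 2 <= M ^+ 2 ->
  (HS_norm B (tensor y y - tensor z z)%R <= M%:E)%E.
Proof.
move=> M0 yzM; apply/(HS_norm_leP oB uF FB F_homo F_exhausts _ M0) => n.
apply: le_trans yzM; apply: le_trans (sum_sqr_tensorB y z n).
apply: ler_sum => e _; apply: ler_sum => f _.
have -> : (tensor y y - tensor z z)%R e = tensor y y e - tensor z z e by [].
by rewrite hdotBr !hdot_tensor.
Qed.

Lemma HS_tensor (y : H) : HS B (tensor y y).
Proof.
split.
- by move=> a u v; rewrite /tensor hdotDr hdotZr scalerDl scalerA.
- move=> x; apply: cvgZ; last exact: cvg_cst.
  exact: continuous_hdotr.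
apply: (@le_lt_trans _ _ (2 * `|y| ^+ 2)%:E); last exact: ltry.
(* The tensor square of 0 is the zero operator, so the distance estimate also bounds a norm. *)
have -> : tensor y y = (tensor y y - tensor (0 : H) 0)%R.
  apply/funext => x; rewrite -[RHS]/(tensor y y x - tensor (0 : H) 0 x).
  by rewrite /tensor scaler0 subr0.
apply: HS_norm_tensorB; first by rewrite mulr_ge0 ?sqr_ge0.
rewrite normr0 subr0; have := sqr_ge0 (`|y| ^+ 2); nra.
Qed.

End tensor_norm.

(** * Expectation of the tensor square *)

Section hs_expectation.
Context {R : realType} {H : hilbertType R} {d : measure_display}
  {T : measurableType d}.
Variables (B : set H) (F : nat -> seq H).
Hypothesis oB : orthonormal_basis B.
Hypothesis uF : forall n, uniq (F n).
Hypothesis FB : forall n e, e \in F n -> B e.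
Hypothesis F_homo : forall m n, (m <= n)%N -> {subset F m <= F n}.
Hypothesis F_exhausts : forall e, B e -> exists n, e \in F n.
Variables (P : probability T R) (Theta : {RV P >-> borel H}).
Hypothesis Theta_sphere : P (Theta @^-1` unit_sphere) = 1%E.

Let normP := HS_norm_leP oB uF FB F_homo F_exhausts.

Lemma HS_simple_integral_coord (s : T -> H -> H) (g h : H) : HS_simple B s ->
  bounded_mfun (fun w => hdot g (s w h)) /\
  hdot g (HS_simple_integral P s h) = mean P (fun w => hdot g (s w h)).
Proof.
move=> [fs ms _]; have /finite_seqP[L0 rL0] := fs.
pose L := undup L0.
have rL : range s = [set` L].
  by rewrite rL0; apply/seteqP; split=> S; rewrite /mkset mem_undup.
have sE w : hdot g (s w h) =
    \sum_(S <- L) hdot g (S h) * \1_(s @^-1` [set S]) w.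
  have sL : s w \in L.
    have : range s (s w) by exists w.
    by rewrite rL.
  rewrite (bigD1_seq (s w)) ?undup_uniq//= indicE mem_set// mulr1.
  rewrite big1 ?addr0// => S Sw; rewrite indicE memNset ?mulr0// => /= e.
  by move: Sw; rewrite e eqxx.
have bS S : bounded_mfun (fun w => hdot g (S h) * \1_(s @^-1` [set S]) w).
  by apply: bounded_mfunZ; exact: bounded_mfun_indic.
have -> : (fun w => hdot g (s w h)) =
    (fun w => \sum_(S <- L) hdot g (S h) * \1_(s @^-1` [set S]) w).
  by apply/funext => w; exact: sE.
split; first exact: bounded_mfun_sum.
rewrite mean_sum// /HS_simple_integral rL -fsbig_seq ?undup_uniq//=.
rewrite fct_sumE hdot_sumr; apply: eq_bigr => S _.
rewrite -[X in hdot _ X]/(fine (P (s @^-1` [set S])) *: S h) hdotZr meanZ; last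
    first.
  exact: bounded_mfun_indic.
by rewrite mean_indic// mulrC.
Qed.

Definition mean_coord (e f : H) : R := mean P (unit_coord e f \o Theta).

Lemma measurable_Theta_sphere : measurable (Theta @^-1` unit_sphere).
Proof.
rewrite -[X in measurable X]setTI.
exact: (@measurable_funPT _ _ _ _ Theta _ _ measurable_unit_sphere).
Qed.

Lemma bounded_mfun_coord_Theta e f : bounded_mfun (fun w => unit_coord e f
    (Theta w)).
Proof. exact: (bounded_mfun_sample Theta (bounded_mfun_coord e f)). Qed.

(** A coordinate is bounded by the Hilbert-Schmidt norm, so the error of the simple integrals and
    the integrated error of the simple maps control it together. Whichever operator [get] selects,
    its coordinates are known. *)
Lemma is_HS_expectation_coord (C : H -> H) e f : B e -> B f ->
  is_HS_expectation B P (fun w => tensor (Theta w : H) (Theta w : H)) C ->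
  hdot f (C e) = mean_coord e f.
Proof.
move=> Be Bf [_ [s [ss _ sF sC]]].
pose N1 n := (\int[P]_w HS_norm B (s n w - tensor (Theta w : H) (Theta w :
    H))%R)%E.
pose N2 n := HS_norm B (HS_simple_integral P (s n) - C)%R.
have key n : (`|hdot f (C e) - mean_coord e f|%:E <= N2 n + N1 n)%E.
  have [bs Cn] := HS_simple_integral_coord f e (ss n).
  apply: (@le_trans _ _ (`|hdot f (HS_simple_integral P (s n) e - C e)|%:E +
    `|hdot f (HS_simple_integral P (s n) e) - mean_coord e f|%:E)%E).
    rewrite -EFinD lee_fin hdotBr -(distrC (hdot f (C e))).
    by apply: le_trans (ler_normD _ _); rewrite addrA subrK.
  apply: leeD.
    exact: (coord_le_HS_norm oB uF FB F_homo F_exhausts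
      (HS_simple_integral P (s n) - C)%R Be Bf).
  rewrite Cn /mean_coord -meanB//; last exact: bounded_mfun_coord_Theta.
  pose g w := hdot f (s n w e) - unit_coord e f (Theta w).
  have bg : bounded_mfun g by apply: bounded_mfunB => //; exact:
      bounded_mfun_coord_Theta.
  have mS := measurable_Theta_sphere.
  (* [unit_coord] is guaranteed to be a coordinate of the tensor only on the unit ball; the
     indicator confines the comparison to the sphere without changing the mean. *)
  pose g1 w := `|g w| * \1_(Theta @^-1` unit_sphere) w.
  have bg1 : bounded_mfun g1.
    by apply: bounded_mfunM; [exact: bounded_mfun_norm|exact:
        bounded_mfun_indic].
  apply: (@le_trans _ _ (mean P g1)%:E).
    rewrite lee_fin (le_trans (ler_norm_mean P bg))// le_eqVlt; apply/orP;
        left; apply/eqP.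
    apply: (mean_negligible mS Theta_sphere) => //; last exact:
        bounded_mfun_norm.
    by move=> w Sw; rewrite /g1 indicE mem_set// mulr1.
  rewrite EFin_mean//; apply: ge0_le_integral_raw => w.
    by rewrite lee_fin mulr_ge0.
  rewrite /g1 indicE; case: (boolP (w \in _)) => [/set_mem Sw|_]; last first.
    by rewrite mulr0 HS_norm_ge0.
  rewrite mulr1 /g /unit_coord unit_retract_id; last by rewrite (Sw : `|Theta w
      : H| = 1).
  rewrite -hdot_tensor -hdotBr.
  exact: (coord_le_HS_norm oB uF FB F_homo F_exhausts
    (s n w - tensor (Theta w : H) (Theta w : H))%R Be Bf).
have c0 : (N2 n + N1 n)%E @[n --> \oo] --> (0 + 0)%E.
  by apply: cvgeD; [|exact: sC|exact: sF].
apply/eqP; rewrite -subr_eq0 -normr_le0 -lee_fin.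
rewrite adde0 in c0; apply: (cvge_to_ge c0); exact: nearW.
Qed.

Variable D : nat -> H.
Hypothesis D_dense : forall x (e : R), 0 < e -> exists n, `|D n - x| < e.

(** With the retraction, boundedness holds for every outcome; the null set off the sphere matters
    only in comparisons with [Theta] itself. *)
Let ret w : H := unit_retract (Theta w : H).
Let y n w : H := nearest D n (ret w).
Let s n w : H -> H := tensor (y n w) (y n w).

Lemma measurable_ret : measurable_fun setT (ret : T -> borel H).
Proof.
apply: (measurableT_comp (f := (@unit_retract R H : borel H -> borel H))).
  by apply: continuous_borel_borel_measurable; exact: continuous_unit_retract.
exact: measurable_funPT.
Qed.

Let delta n w : R := nearest_dist D n (ret w).

Lemma delta_bounds n w : 0 <= delta n w <= 1.
Proof.
rewrite nearest_dist_ge0 /= (le_trans (nearest_dist_le _ _ _))//.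
exact: norm_unit_retract.
Qed.

Lemma bounded_mfun_delta n : bounded_mfun (delta n).
Proof.
split; last first.
  by exists 1 => w; have /andP[h1 h2] := delta_bounds n w; rewrite ger0_norm.
apply: (measurableT_comp (f := (nearest_dist D n : borel H -> R))).
  by apply: continuous_borel_measurable; exact: continuous_nearest_dist.
exact: measurable_ret.
Qed.

Let eta n : R := mean P (delta n).

Lemma eta_ge0 n : 0 <= eta n.
Proof. by apply: mean_ge0 => w; case/andP: (delta_bounds n w). Qed.

Lemma eta_cvg : eta n @[n --> \oo] --> (0 : R).
Proof.
rewrite -(mean_cst P 0); apply: (@bounded_mean_cvg _ _ _ _ delta (cst 0) 1).
- exact: bounded_mfun_delta.
- exact: bounded_mfun_cst.
- by move=> n w; have /andP[h1 h2] := delta_bounds n w; rewrite ger0_norm.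
- by move=> w; exact: nearest_dist_cvg.
Qed.

Lemma HS_simple_nearest n : HS_simple B (s n).
Proof.
have my : measurable_fun setT (y n : T -> borel H).
  apply: (measurableT_comp (f := (nearest D n : borel H -> borel H))).
    exact: measurable_nearest.
  exact: measurable_ret.
have fy : finite_set (range (y n)).
  apply: sub_finite_set (finite_range_nearest D n) => _ [w _ <-]; exists (ret
      w) => //.
split.
- apply: sub_finite_set (finite_image (fun v => tensor v v) fy).
  by move=> _ [w _ <-]; exists (y n w) => //; exists w.
- move=> S.
  (* Opposite points have the same tensor square, so a level set of [s n] is a finite union of level
     sets of [y n]. *)
  have -> : s n @^-1` [set S] =
      \bigcup_(v in range (y n) `&` [set v | tensor v v = S]) (y n @^-1` [set
          v]).
    apply/seteqP; split => [w <-|w [v [_ <-]] /= yv]; last by rewrite /s yv.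
    by exists (y n w) => //; split => //; exists w.
  apply: fin_bigcup_measurable; first exact: finite_setIl.
  move=> v _; rewrite -[X in measurable X]setTI; apply: my => //.
  exact: measurable_set1_borel.
- by move=> w; exact: (HS_tensor oB uF FB F_homo F_exhausts).
Qed.

(** The constant is 2 + 1, from the bounds 2 on the nearest point and 1 on the retracted point. *)
Lemma nearest_tensor_coord n w g h :
  `|hdot g (s n w h) - unit_coord h g (Theta w)| <= 3 * `|g| * `|h| * delta n w.
Proof.
rewrite /s hdot_tensor /unit_coord -/(ret w).
have -> : hdot h (y n w) * hdot g (y n w) - hdot h (ret w) * hdot g (ret w) =
    hdot h (y n w) * hdot g (y n w - ret w) + hdot h (y n w - ret w) * hdot g
        (ret w).
  by rewrite !hdotBr; ring.
have r1 : `|ret w| <= 1 := norm_unit_retract _.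
have y2 : `|y n w| <= 2.
  by apply: le_trans (norm_nearest_le _ _ _) _; rewrite -/(ret w); lra.
have yd : `|y n w - ret w| = delta n w by exact: norm_nearest_sub.
have h1 := hdot_CauchySchwarz h (y n w).
have h2 := hdot_CauchySchwarz g (y n w - ret w).
have h3 := hdot_CauchySchwarz h (y n w - ret w).
have h4 := hdot_CauchySchwarz g (ret w).
have /andP[d0 _] := delta_bounds n w.
rewrite yd in h2 h3.
apply: (le_trans (ler_normD _ _)); rewrite !normrM.
apply: (@le_trans _ _ ((`|h| * 2) * (`|g| * delta n w) + (`|h| * delta n w) *
    (`|g| * 1))).
  apply: lerD; apply: ler_pM => //.
    by apply: le_trans h1 _; rewrite ler_wpM2l.
  by apply: le_trans h4 _; rewrite ler_wpM2l.
rewrite le_eqVlt; apply/orP; left; apply/eqP; ring.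
Qed.

Let Cn n := HS_simple_integral P (s n).

Lemma Cn_coord n g h : `|hdot g (Cn n h) - mean_coord h g| <= 3 * `|g| * `|h| *
    eta n.
Proof.
have [bs ->] := HS_simple_integral_coord g h (HS_simple_nearest n).
rewrite /mean_coord -meanB//; last exact: bounded_mfun_coord_Theta.
have bd : bounded_mfun (fun w => hdot g (s n w h) - unit_coord h g (Theta w)).
  by apply: bounded_mfunB => //; exact: bounded_mfun_coord_Theta.
apply: (le_trans (ler_norm_mean P bd)).
rewrite /eta -meanZ; last exact: bounded_mfun_delta.
apply: le_mean; [exact:
    bounded_mfun_norm|exact/bounded_mfunZ/bounded_mfun_delta|].
by move=> w; exact: nearest_tensor_coord.
Qed.

Lemma Cn_cauchy m n h : `|Cn m h - Cn n h| <= 3 * `|h| * (eta m + eta n).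
Proof.
apply: norm_le_hdot; first by rewrite !mulr_ge0 ?addr_ge0 ?eta_ge0.
move=> g; rewrite hdotC hdotBr.
have := Cn_coord m g h; have := Cn_coord n g h.
rewrite !ler_norml => /andP[h1 h2] /andP[h3 h4]; lra.
Qed.

Lemma Cn_cvg h : cvg (Cn n h @[n --> \oo]).
Proof.
apply/cauchy_cvgP/cauchy_ballP => e e0.
pose a : R := 3 * `|h| + 1.
have a0 : 0 < a by rewrite /a ltr_wpDl ?mulr_ge0.
have : \forall n \near \oo, eta n < e / (2 * a).
  by apply: (cvgr_lt _ eta_cvg); rewrite divr_gt0// mulr_gt0.
move=> [N _ hN].
exists ([set Cn n h | n in [set n | (N <= n)%N]], [set Cn n h | n in [set n |
    (N <= n)%N]]).
  by split; exists N => // n /= Nn; exists n.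
move=> [_ _] /= [[m Nm <-] [n Nn <-]]; rewrite -ball_normE /=.
apply: le_lt_trans (Cn_cauchy m n h) _.
have h1 := hN _ Nm; have h2 := hN _ Nn; rewrite /= in h1 h2.
have e1 : 0 <= eta m + eta n by rewrite addr_ge0 ?eta_ge0.
apply: (@le_lt_trans _ _ (a * (eta m + eta n))).
  by rewrite ler_wpM2r// /a lerDl.
have -> : e = a * (e / (2 * a) + e / (2 * a)) by field; rewrite gt_eqF.
by rewrite ltr_pM2l// ltrD.
Qed.

(** The simple integrals are Cauchy at each vector, so the completeness of [H] itself provides the
    limit operator. *)
Let C h : H := lim (Cn n h @[n --> \oo]).

Lemma C_coord g h : hdot g (C h) = mean_coord h g.
Proof.
have c1 : hdot g (Cn n h) @[n --> \oo] --> hdot g (C h).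
  by apply: continuous_cvg; [exact: continuous_hdotr|exact: Cn_cvg].
have c2 : hdot g (Cn n h) @[n --> \oo] --> mean_coord h g.
  apply/cvgrPdist_le => e e0.
  have ce : 3 * `|g| * `|h| * eta n @[n --> \oo] --> 3 * `|g| * `|h| * 0.
    by apply: cvgM; [exact: cvg_cst|exact: eta_cvg].
  rewrite mulr0 in ce; near=> n.
  rewrite distrC (le_trans (Cn_coord n g h))//; near: n.
  exact: (cvgr_le _ ce).
exact: (cvg_unique _ c1 c2).
Unshelve. all: by end_near. Qed.

Lemma mean_coord_linear a u v g :
  mean_coord (a *: u + v) g = a * mean_coord u g + mean_coord v g.
Proof.
rewrite /mean_coord -meanZ; last exact: bounded_mfun_coord_Theta.
rewrite -meanD; [|exact/bounded_mfunZ/bounded_mfun_coord_Theta|exact: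
    bounded_mfun_coord_Theta].
by apply: eq_mean => w; rewrite /= /unit_coord hdotDl hdotZl; ring.
Qed.

Lemma C_linear : linear C.
Proof.
move=> a u v; apply: eq_hdot => g.
by rewrite hdotC C_coord mean_coord_linear hdotDl hdotZl !(hdotC (C _))
    !C_coord.
Qed.

Lemma norm_C_le h : `|C h| <= `|h|.
Proof.
apply: norm_le_hdot => // g; rewrite hdotC C_coord.
rewrite -(mean_cst P (`|h| * `|g|)); apply: le_mean.
- exact: bounded_mfun_coord_Theta.
- exact: bounded_mfun_cst.
move=> w; apply: le_trans (ler_norm _) _; rewrite normrM.
by apply: ler_pM => //; exact: norm_coord1_le.
Qed.

Lemma C_continuous : continuous C.
Proof.
move=> x; apply/cvgrPdist_lt => e e0; near=> z.
have -> : C x - C z = C (x - z).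
  by have := C_linear (-1) z x; rewrite !scaleN1r ![- _ + _]addrC => ->.
apply: le_lt_trans (norm_C_le _) _; near: z.
by apply: (@cvgr_dist_lt _ _ _ (nbhs x) _ id) => //; exact: cvg_id.
Unshelve. all: by end_near. Qed.

(** Jensen in each coordinate: a pointwise bound on the integrand passes to the averaged operator,
    in place of a norm inequality for Bochner integrals. *)
Lemma hs_trunc_mean_le (A : H -> H) (M : T -> R) (g : H -> H -> T -> R) n :
  (forall e f, bounded_mfun (g e f)) -> (forall e f, hdot f (A e) = mean P (g e
      f)) ->
  bounded_mfun M ->
  (forall w, \sum_(e <- F n) \sum_(f <- F n) g e f w ^+ 2 <= M w) ->
  hs_trunc F A n <= mean P M.
Proof.
move=> bg Ag bM gM; have bg2 e f := bounded_mfunX 2 (bg e f).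
have bs e : bounded_mfun (fun w => \sum_(f <- F n) g e f w ^+ 2) by exact:
    bounded_mfun_sum.
apply: (@le_trans _ _ (mean P (fun w => \sum_(e <- F n) \sum_(f <- F n) g e f w
    ^+ 2))).
  rewrite mean_sum//; apply: ler_sum => e _; rewrite mean_sum//.
  by apply: ler_sum => f _; rewrite Ag; exact: sqr_mean_le.
by apply: le_mean => //; exact: bounded_mfun_sum.
Qed.

Lemma HS_C : HS B C.
Proof.
split; [exact: C_linear|exact: C_continuous|].
apply: (@le_lt_trans _ _ 1%:E); last exact: ltry.
apply/(normP _ ler01) => n; rewrite expr1n.
rewrite -[leRHS](mean_cst P).
apply: (@hs_trunc_mean_le C (cst 1) (fun e f w => unit_coord e f (Theta w))).
- exact: bounded_mfun_coord_Theta.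
- by move=> e f; rewrite C_coord.
- exact: bounded_mfun_cst.
move=> w; rewrite sum_sqr_coord expr_le1 ?energy_ge0//.
exact: (energy_le1 oB uF FB).
Qed.

(** The factor is at most 2 * (4 + 1) = 10, rounded up to the square 16. *)
Lemma nearest_sqr_le n w :
  2 * (`|y n w| ^+ 2 + `|ret w| ^+ 2) * `|y n w - ret w| ^+ 2 <= (4 * delta n
      w) ^+ 2.
Proof.
have r1 : `|ret w| <= 1 := norm_unit_retract _.
have y2 : `|y n w| <= 2.
  by apply: le_trans (norm_nearest_le _ _ _) _; rewrite -/(ret w); lra.
have -> : `|y n w - ret w| = delta n w by exact: norm_nearest_sub.
have -> : (4 * delta n w) ^+ 2 = 16 * delta n w ^+ 2 by ring.
rewrite ler_wpM2r ?sqr_ge0//.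
have h1 : `|ret w| ^+ 2 <= 1 by rewrite expr_le1.
have h2 : `|y n w| ^+ 2 <= 2 ^+ 2 by rewrite ler_sqr ?nnegrE.
lra.
Qed.

Lemma Cn_HS_cvg : HS_norm B (Cn n - C)%R @[n --> \oo] --> 0%E.
Proof.
(* The squared norm is at most 16 times the mean of [delta n ^+ 2], hence at most [16 * eta n] since
   [delta n <= 1]. *)
apply: (@squeeze_cvge _ _ _ _ (cst 0%E) _ (fun n => (4 * Num.sqrt (eta n))%:E)).
- apply: nearW => n; rewrite HS_norm_ge0 /=.
  have M0 : 0 <= 4 * Num.sqrt (eta n) by rewrite mulr_ge0 ?sqrtr_ge0.
  apply/(normP _ M0) => N.
  have -> : (4 * Num.sqrt (eta n)) ^+ 2 = 16 * eta n.
    by rewrite exprMn sqr_sqrtr ?eta_ge0//; ring.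
  pose g e f w := hdot f (s n w e) - unit_coord e f (Theta w).
  have bg e f : bounded_mfun (g e f).
    apply: bounded_mfunB; last exact: bounded_mfun_coord_Theta.
    by have [] := HS_simple_integral_coord f e (HS_simple_nearest n).
  rewrite -meanZ; last exact: bounded_mfun_delta.
  apply: (@hs_trunc_mean_le _ _ g) => //; last 2 first.
  - exact/bounded_mfunZ/bounded_mfun_delta.
  - move=> w; apply: (@le_trans _ _ ((4 * delta n w) ^+ 2)).
      apply: le_trans (nearest_sqr_le n w).
      apply: le_trans (sum_sqr_tensorB oB uF FB (y n w) (ret w) N).
      by apply: ler_sum => e _; apply: ler_sum => f _; rewrite /g hdot_tensor.
    have /andP[d0 d1] := delta_bounds n w; nra.
  move=> e f; rewrite -[X in hdot f X]/(Cn n e - C e) hdotBr C_coord.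
  have [bn ->] := HS_simple_integral_coord f e (HS_simple_nearest n).
  by rewrite /mean_coord -meanB//; exact: bounded_mfun_coord_Theta.
- exact: cvg_cst.
apply: cvg_EFin; first exact: nearW.
have -> : 0 = 4 * Num.sqrt 0 :> R by rewrite sqrtr0 mulr0.
apply: cvgM; first exact: cvg_cst.
by apply: (cvg_comp _ _ eta_cvg); exact: sqrt_continuous.
Qed.

(** Valid for every outcome. The bound is a continuous function of [Theta], hence a measurable
    majorant of the norm, and it reduces to [8 * delta n w] on the sphere. *)
Lemma HS_norm_nearest_le n w :
  (HS_norm B (s n w - tensor (Theta w : H) (Theta w : H))%R <=
   (4 * (1 + `|Theta w : H|) * (delta n w + `|ret w - (Theta w : H)|))%:E)%E.
Proof.
set t := Theta w : H; have /andP[d0 d1] := delta_bounds n w.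
have r1 : `|ret w| <= 1 := norm_unit_retract _.
have y2 : `|y n w| <= 2.
  by apply: le_trans (norm_nearest_le _ _ _) _; rewrite -/(ret w); lra.
have yt : `|y n w - t| <= delta n w + `|ret w - t|.
  have -> : delta n w = `|y n w - ret w| by apply/esym; exact: norm_nearest_sub.
  by apply: le_trans (ler_normD _ _); rewrite addrA subrK.
have rt0 := normr_ge0 (ret w - t); have t0 := normr_ge0 t.
apply: (HS_norm_tensorB oB uF FB F_homo F_exhausts).
  by rewrite !mulr_ge0 ?addr_ge0.
rewrite [leRHS]exprMn; apply: ler_pM.
- by rewrite mulr_ge0 ?addr_ge0 ?sqr_ge0.
- by rewrite sqr_ge0.
- have h2 : `|y n w| ^+ 2 <= 2 ^+ 2 by rewrite ler_sqr ?nnegrE.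
  nra.
by rewrite ler_sqr ?nnegrE ?addr_ge0.
Qed.

Lemma ret_Theta w : unit_sphere (Theta w : H) -> ret w = Theta w.
Proof. by move=> Sw; rewrite /ret unit_retract_id// (Sw : `|Theta w : H| = 1).
    Qed.

Lemma integral_HS_norm_nearest_cvg :
  (\int[P]_w HS_norm B (s n w - tensor (Theta w : H) (Theta w : H))%R)%E
    @[n --> \oo] --> 0%E.
Proof.
have mS := measurable_Theta_sphere.
have PCS : P (~` (Theta @^-1` unit_sphere)) = 0%E.
  by rewrite probability_setC// Theta_sphere subee.
apply: (@squeeze_cvge _ _ _ _ (cst 0%E) _ (fun n => (8 * eta n)%:E)).
- apply: nearW => n; rewrite integral_ge0 /=; last by move=> w _; exact:
    HS_norm_ge0.
  pose G (x : H) := 4 * (1 + `|x|) * (nearest_dist D n (unit_retract x) +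
      `|unit_retract x - x|).
  have G0 x : 0 <= G x by rewrite !mulr_ge0 ?addr_ge0 ?nearest_dist_ge0.
  have cG : continuous G.
    move=> x; apply: cvgM.
      apply: cvgM; first exact: cvg_cst.
      by apply: cvgD; [exact: cvg_cst|exact: norm_continuous].
    apply: cvgD.
      apply: (@continuous_comp _ _ _ (@unit_retract R H) (nearest_dist D n)).
        exact: continuous_unit_retract.
      exact: continuous_nearest_dist.
    apply: cvg_norm; apply: cvgB; last exact: cvg_id.
    exact: continuous_unit_retract.
  have mG : measurable_fun setT (fun w => (G (Theta w))%:E).
    apply/measurable_EFinP; apply: (measurableT_comp (f := (G : borel H -> R))).
      exact: continuous_borel_measurable.
    exact: measurable_funPT.
  apply: (@le_trans _ _ (\int[P]_w (G (Theta w))%:E)%E).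
    apply: ge0_le_integral_raw => w; first exact: HS_norm_ge0.
    exact: HS_norm_nearest_le.
  rewrite (ge0_negligible_integral (measurableC mS) measurableT mG)//; last
      first.
    by move=> w _; rewrite lee_fin.
  rewrite setTD setCK -meanZ; last exact: bounded_mfun_delta.
  have b8 := bounded_mfunZ 8 (bounded_mfun_delta n).
  rewrite EFin_mean//.
  rewrite [leRHS](negligible_integral (measurableC mS) measurableT
      (bounded_mfun_integrable P b8))//.
  rewrite setTD setCK le_eqVlt; apply/orP; left; apply/eqP; apply: eq_integral
      => w /set_mem Sw.
  congr EFin; rewrite /G /= -/(ret w) (ret_Theta Sw) (Sw : `|Theta w : H| = 1).
  by rewrite subrr normr0 addr0 /delta (ret_Theta Sw); ring.
- exact: cvg_cst.
apply: cvg_EFin; first exact: nearW.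
have -> : 0 = 8 * 0 :> R by rewrite mulr0.
by apply: cvgM; [exact: cvg_cst|exact: eta_cvg].
Qed.

Lemma ae_HS_norm_nearest_cvg :
  {ae P, forall w, HS_norm B (s n w - tensor (Theta w : H) (Theta w : H))%R
    @[n --> \oo] --> 0%E}.
Proof.
have mS := measurable_Theta_sphere.
exists (~` (Theta @^-1` unit_sphere)); split; first exact: measurableC.
  by rewrite probability_setC// Theta_sphere subee.
apply: subsetC => w Sw /=.
apply: (@squeeze_cvge _ _ _ _ (cst 0%E) _ (fun n => (8 * delta n w)%:E)).
- apply: nearW => n; rewrite HS_norm_ge0 /=.
  apply: le_trans (HS_norm_nearest_le n w) _; rewrite lee_fin.
  rewrite (ret_Theta Sw) subrr normr0 addr0 (Sw : `|Theta w : H| = 1).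
  by rewrite le_eqVlt; apply/orP; left; apply/eqP; ring.
- exact: cvg_cst.
apply: cvg_EFin; first exact: nearW.
have -> : 0 = 8 * 0 :> R by rewrite mulr0.
by apply: cvgM; [exact: cvg_cst|exact: nearest_dist_cvg].
Qed.

Lemma exists_HS_expectation :
  exists C, is_HS_expectation B P (fun w => tensor (Theta w : H) (Theta w : H))
      C.
Proof.
exists C; split; first exact: HS_C.
exists s; split; [exact: HS_simple_nearest|exact: ae_HS_norm_nearest_cvg|
  exact: integral_HS_norm_nearest_cvg|exact: Cn_HS_cvg].
Qed.

End hs_expectation.

(** * Consistency *)

Section defect_limit.
Context {R : realType} {H : hilbertType R}.
Variables (B : set H) (F : nat -> seq H) (Q : probability (borel H) R).
Hypothesis oB : orthonormal_basis B.
Hypothesis uF : forall n, uniq (F n).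
Hypothesis FB : forall n e, e \in F n -> B e.
Hypothesis F_homo : forall m n, (m <= n)%N -> {subset F m <= F n}.
Hypothesis F_exhausts : forall e, B e -> exists n, e \in F n.
Hypothesis Q_sphere : Q unit_sphere = 1%E.

(** By Parseval the defect tends to one minus the fourth power of the norm of the retracted point,
    which vanishes on the sphere; dominated convergence concludes. *)
Lemma mean_energy_defect_cvg :
  mean Q (energy_defect (F n)) @[n --> \oo] --> (0 : R).
Proof.
pose g (x : borel H) : R := 1 - (`|unit_retract (x : H)| ^+ 2) ^+ 2.
have n1 (x : H) : `|unit_retract x| ^+ 2 <= 1.
  by rewrite expr_le1// norm_unit_retract.
have bg : bounded_mfun g.
  split; last first.
    exists 1 => x; have := n1 x; have := sqr_ge0 `|unit_retract (x : H)|.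
    by rewrite /g ler_norml; set u := _ ^+ 2 => *; apply/andP; split; nra.
  apply: continuous_borel_measurable => x; apply: cvgB; first exact: cvg_cst.
  have cn : (fun x : H => `|unit_retract x|) @ x --> `|unit_retract x|.
    by apply: cvg_norm; exact: continuous_unit_retract.
  have cn2 : (fun x : H => `|unit_retract x| ^+ 2) @ x --> `|unit_retract x| ^+
      2.
    by rewrite /= expr2; under eq_fun do rewrite expr2; apply: cvgM.
  by rewrite [X in _ --> X]expr2; under eq_fun do rewrite expr2; apply: cvgM.
have -> : 0 = mean Q g.
  rewrite -[LHS](mean_cst Q); apply: (mean_negligible (measurable_unit_sphere
      (H := H)) Q_sphere) => //.
  - move=> x Sx; rewrite /g unit_retract_id; last by rewrite (Sx : `|x : H| =
      1).
    by rewrite (Sx : `|x : H| = 1) !expr1n subrr.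
  - exact: bounded_mfun_cst.
apply: (@bounded_mean_cvg _ _ _ _ _ _ 1) => //.
- by move=> n; exact: bounded_mfun_energy_defect.
- move=> n x; have h1 := energy_le1 oB uF FB n x; have h0 := energy_ge0 (F n) x.
  by rewrite /energy_defect ler_norml; apply/andP; split; nra.
move=> x; apply: cvgB; first exact: cvg_cst.
have ce : energy (F n) x @[n --> \oo] --> `|unit_retract (x : H)| ^+ 2.
  exact: (parseval oB uF FB F_homo F_exhausts).
by rewrite [X in _ --> X]expr2; under eq_fun do rewrite expr2; apply: cvgM.
Qed.

End defect_limit.

Lemma measure_exists_le {d : measure_display} {T : measurableType d} {R :
    realType}
    (P : probability T R) {I : eqType} (s : seq I) (A : I -> set T) :
  (forall i, measurable (A i)) ->
  measurable [set w | exists2 i, i \in s & A i w] /\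
  (P [set w | exists2 i, i \in s & A i w] <= \sum_(i <- s) P (A i))%E.
Proof.
move=> mA; elim: s => [|i s [ms IH]].
  rewrite (_ : [set _ | _] = set0) ?measure0 ?big_nil; first by split.
  by apply/seteqP; split=> // w [].
have -> : [set w | exists2 j, j \in i :: s & A j w] =
    A i `|` [set w | exists2 j, j \in s & A j w].
  apply/seteqP; split => [w [j]|w [Aw|[j js Aw]]].
  - by rewrite in_cons => /orP[/eqP -> Aw|js Aw]; [left|right; exists j].
  - by exists i => //; exact: mem_head.
  - by exists j => //; rewrite in_cons js orbT.
split; first exact: measurableU.
rewrite big_cons; apply: (le_trans (measureU2 _ _ _)) => //.
exact: leeD2l.
Qed.

Lemma sum_sqr_le {R : realType} {I : Type} (s : seq I) (c : R) (G : I -> I ->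
    R) :
  (forall i j, G i j <= c ^+ 2) ->
  \sum_(i <- s) \sum_(j <- s) G i j <= ((size s)%:R * c) ^+ 2.
Proof.
move=> Gc; apply: (@le_trans _ _ (\sum_(i <- s) \sum_(j <- s) c ^+ 2)).
  by apply: ler_sum => i _; exact: ler_sum.
rewrite !big_const_seq !count_predT !iter_addr_0 -mulrnA -[leLHS]mulr_natl.
by rewrite natrM exprMn -expr2.
Qed.

Lemma cvg_sume0 {R : realType} {I : Type} (s : seq I) (u : I -> nat -> \bar R) :
  (forall i, u i n @[n --> \oo] --> 0%E) ->
  (\sum_(i <- s) u i n)%E @[n --> \oo] --> 0%E.
Proof.
move=> u0; elim: s => [|i s IH].
  by under eq_fun do rewrite big_nil; exact: cvg_cst.
under eq_fun do rewrite big_cons.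
have := @cvgeD _ _ _ _ (u i) (fun n => \sum_(j <- s) u j n)%E 0%E 0%E.
by rewrite adde0; apply.
Qed.

Section emp_cov_coordinates.
Context {R : realType} {H : hilbertType R} {d : measure_display}
  {T : measurableType d}.
Variables (P : probability T R) (X_ : nat -> {RV P >-> borel H})
  (sigma : forall n, T -> 'S_n).

Lemma hdot_emp_cov n k w (e f : H) :
  hdot f (emp_cov (fun i => X_ i) sigma n k w e) =
  top_avg X_ sigma n k (unit_coord e f) w.
Proof.
rewrite /emp_cov /top_avg.
set S := \sum_(i < n | _) _.
rewrite -[X in hdot f X]/(k%:R^-1 *: S e) hdotZr; congr (_ * _).
rewrite /S fct_sumE hdot_sumr; apply: eq_bigr => i _.
by rewrite hdot_tensor /unit_coord unit_retract_id// norm_angle_le1.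
Qed.

End emp_cov_coordinates.

Theorem corollary4p2 (R : realType) (H : hilbertType R)
  (d : measure_display) (T : measurableType d) (P : probability T R)
  (X : {RV P >-> borel H}) (alpha : R) (Q : probability (borel H) R)
  (X_ : nat -> {RV P >-> borel H})
  (sigma : forall n, T -> 'S_n)
  (d' : measure_display) (T' : measurableType d') (P' : probability T' R)
  (Theta_oo : {RV P' >-> borel H}) (k : nat -> nat) :
  separable H ->
  regularly_varying P X alpha ->
  limit_angular_measure P X Q ->
  (forall i (A : set (borel H)), measurable A ->
     distribution P (X_ i) A = distribution P X A) ->
  mutually_independent P (fun i => X_ i) ->
  norm_ordering (fun i => X_ i) sigma ->
  (forall A : set (borel H), measurable A ->
     distribution P' Theta_oo A = Q A) ->
  (forall n, (0 < n)%N -> (1 <= k n <= n)%N) ->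
  k n @[n --> \oo] --> \oo ->
  (k n)%:R / n%:R @[n --> \oo] --> (0 : R) ->
  forall B : set H, orthonormal_basis B ->
  let C_oo := HS_expectation B P' (fun w => tensor (Theta_oo w) (Theta_oo w)) in
  forall eps : R, 0 < eps ->
    P [set w | (eps%:E < HS_norm B
         (emp_cov (fun i => X_ i) sigma n (k n) w - C_oo)%R)%E]
      @[n --> \oo] --> 0%E.
Proof.
move=> sH X_rv X_Q X_iid X_indep X_ord Theta_Q k_bounds k_cvg k_ratio B oB C
    eps eps0.
have [F [uF FB F_homo F_exhausts]] := exists_basis_exhaustion sH oB.
have [D D_dense] := separable_dense_seq sH.
have Q_sphere : Q unit_sphere = 1%E by case: X_Q.
have Theta_sphere : P' (Theta_oo @^-1` unit_sphere) = 1%E.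
  by rewrite -Q_sphere -Theta_Q//; exact: measurable_unit_sphere.
have CE : is_HS_expectation B P' (fun w => tensor (Theta_oo w : H) (Theta_oo w
    : H)) C.
  apply: getPex.
  exact: (exists_HS_expectation oB uF FB F_homo F_exhausts Theta_sphere
      D_dense).
have C_coord e f : B e -> B f -> hdot f (C e) = mean Q (unit_coord e f).
  move=> Be Bf; rewrite (is_HS_expectation_coord oB uF FB F_homo F_exhausts
      Theta_sphere Be Bf CE).
  by apply: mean_distribution => //; exact: bounded_mfun_coord.
pose S n w := (emp_cov (fun i => X_ i) sigma n (k n) w - C)%R.
pose L n w psi := top_avg X_ sigma n (k n) psi w.
have truncE n w N : hs_trunc F (S n w) N =
    \sum_(e <- F N) \sum_(f <- F N)
      (L n w (unit_coord e f) - mean Q (unit_coord e f)) ^+ 2.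
  apply: eq_big_seq => e eN; apply: eq_big_seq => f fN.
  rewrite -[X in hdot f X]/(emp_cov (fun i => X_ i) sigma n (k n) w e - C e)
      hdotBr.
  by rewrite hdot_emp_cov C_coord//; [exact: FB eN|exact: FB fN].
have bL n psi : bounded_mfun psi -> bounded_mfun (fun w => L n w psi - mean Q
    psi).
  move=> bpsi; apply: bounded_mfunB; last exact: bounded_mfun_cst.
  exact: (bounded_mfun_top_avg X_ord n (k n) bpsi).
(* The norm exceeds [eps] when some block sum exceeds [eps ^+ 2], and each block sum is a bounded
   random variable. *)
have measE n : measurable [set w | (eps%:E < HS_norm B (S n w))%E].
  have -> : [set w | (eps%:E < HS_norm B (S n w))%E] =
      \bigcup_N [set w | eps ^+ 2 < `|hs_trunc F (S n w) N|].
    apply/seteqP; split => [w /= /(HS_norm_gtP oB uF FB F_homo F_exhausts _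
        (ltW eps0))[N h]|
        w [N _ /= h]].
      by exists N => //=; rewrite ger0_norm ?hs_trunc_ge0.
    apply/(HS_norm_gtP oB uF FB F_homo F_exhausts _ (ltW eps0)); exists N.
    by rewrite ger0_norm ?hs_trunc_ge0 in h.
  apply: bigcupT_measurable => N; apply: measurable_gt_norm.
  rewrite (_ : (fun w => hs_trunc F (S n w) N) = (fun w => \sum_(e <- F N)
      \sum_(f <- F N)
      (L n w (unit_coord e f) - mean Q (unit_coord e f)) ^+ 2)).
    by apply: (bounded_mfun_sum _ _ _).1 => e; apply: bounded_mfun_sum => f;
      apply: bounded_mfunX; apply: bL; exact: bounded_mfun_coord.
  by apply/funext => w; exact: truncE.
(* The sample defect exceeds the one under [Q] by at most [delta <= eps^2 / 8], so the outer entries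
   contribute at most [2 (2 eps^2 / 16 + eps^2 / 8) = eps^2 / 2]. *)
have [N defectN] : exists N, mean Q (energy_defect (F N)) < eps ^+ 2 / 16.
  have : \forall N \near \oo, mean Q (energy_defect (F N)) < eps ^+ 2 / 16.
    apply: (cvgr_lt _ (mean_energy_defect_cvg oB uF FB F_homo F_exhausts
        Q_sphere)).
    by rewrite divr_gt0// exprn_gt0.
  by move=> [N _ h]; exists N; exact: (h N (leqnn N)).
(* The second bound makes [size (F N) * delta] at most [eps / 2], so the block contributes at most
   [eps^2 / 4]; the added 1 keeps the denominator positive for an empty block. *)
pose delta : R := Num.min (eps ^+ 2 / 8) (eps / (2 * (size (F N))%:R + 1)).
have sz0 : 0 < 2 * (size (F N))%:R + 1 :> R by rewrite ltr_wpDl// mulr_ge0.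
have delta0 : 0 < delta by rewrite lt_min !divr_gt0// exprn_gt0.
pose psis : seq (borel H -> R) := energy_defect (F N) ::
  [seq unit_coord e f | e <- F N, f <- F N].
pose A n (psi : borel H -> R) : set T := [set w | delta < `|L n w psi - mean Q
    psi|].
have psi_nice psi : psi \in psis -> continuous (psi : H -> R) /\ bounded_mfun
    psi.
  rewrite in_cons => /orP[/eqP ->|/allpairsP[[e f] [_ _ ->]]].
    by split; [exact: continuous_energy_defect|exact:
        bounded_mfun_energy_defect].
  by split; [exact: continuous_coord|exact: bounded_mfun_coord].
(* Emptied outside [psis], so that measurability and convergence hold for every index, as the union
   bound and the limit of the sum require. *)
pose A' n psi : set T := if psi \in psis then A n psi else set0.
have mA' n psi : measurable (A' n psi).
  rewrite /A'; case: ifPn => // /psi_nice[_ bpsi].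
  by apply: measurable_gt_norm; case: (bL n _ bpsi).
have incl n : (0 < n)%N -> [set w | (eps%:E < HS_norm B (S n w))%E] `<=`
    [set w | exists2 psi, psi \in psis & A' n psi w].
  move=> n0 w /= /(HS_norm_gtP oB uF FB F_homo F_exhausts _ (ltW eps0))[M].
  apply: contraPP => noA; apply/negP; rewrite -leNgt truncE.
  have small psi : psi \in psis -> `|L n w psi - mean Q psi| <= delta.
    move=> ps; rewrite leNgt; apply/negP => h; apply: noA; exists psi => //.
    by rewrite /A' ps.
  have pL := positive_functional_top_avg X_ sigma w (k_bounds n n0).
  have := coord_functional_distance oB uF FB F_homo N M pL
      (positive_functional_mean Q).
  move/le_trans; apply.
  have h1 : \sum_(e <- F N) \sum_(f <- F N)
      (L n w (unit_coord e f) - mean Q (unit_coord e f)) ^+ 2 <= (eps / 2) ^+ 2.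
    apply: (@le_trans _ _ (((size (F N))%:R * delta) ^+ 2)).
      apply: le_trans (_ : \sum_(e <- F N) \sum_(f <- F N) delta ^+ 2 <= _);
          last exact: sum_sqr_le.
      rewrite big_seq [leRHS]big_seq; apply: ler_sum => e eN.
      rewrite big_seq [leRHS]big_seq; apply: ler_sum => f fN.
      rewrite -[leLHS]real_normK ?num_real// ler_sqr ?nnegrE ?(ltW delta0)//.
      apply: small; rewrite in_cons; apply/orP; right.
      by apply/allpairsP; exists (e, f).
    rewrite ler_sqr ?nnegrE ?mulr_ge0 ?(ltW delta0) ?(ltW eps0)//.
    have : delta <= eps / (2 * (size (F N))%:R + 1) by rewrite ge_min lexx orbT.
    by rewrite ler_pdivlMr//; move: (ltW delta0); lra.
  have h2 := small _ (mem_head _ _); have d8 : delta <= eps ^+ 2 / 8 by rewrite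
      ge_min lexx.
  move: h2; rewrite ler_norml => /andP[_ h2].
  have e2 := exprn_gt0 2 eps0.
  have -> : eps ^+ 2 = (eps / 2) ^+ 2 + 3 / 4 * eps ^+ 2 by field.
  rewrite lerD// -/(L n w _); lra.
have cA' psi : psi \in psis -> P (A' n psi) @[n --> \oo] --> 0%E.
  move=> ps; have [cpsi bpsi] := psi_nice _ ps; rewrite /A' ps.
  by have := top_avg_cvg X_iid X_indep X_ord X_rv X_Q k_bounds k_cvg k_ratio
      cpsi bpsi delta0.
have csum : (\sum_(psi <- psis) P (A' n psi))%E @[n --> \oo] --> 0%E.
  have cA psi : P (A' n psi) @[n --> \oo] --> 0%E.
    have [ps|ps] := boolP (psi \in psis); first exact: cA'.
    by rewrite /A' (negbTE ps) measure0; exact: cvg_cst.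
  exact: (cvg_sume0 psis cA).
apply: (@squeeze_cvge _ _ _ _ (cst 0%E) _ (fun n => (\sum_(psi <- psis) P (A' n
    psi))%E)) => //; last exact: cvg_cst.
near=> n; rewrite measure_ge0 /=.
have [mE leE] := measure_exists_le P psis (mA' n).
apply: le_trans leE; apply: le_measure.
- by apply/mem_set; exact: measE.
- exact/mem_set.
- by apply: incl; near: n; exists 1%N.
Unshelve. all: by end_near. Qed.
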